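(* Let $(R,P_R)$ be a commutative Rota-Baxter algebra of weight $\lambda$ over $\mathbf{k}$. Let $S$ be a multiplicative subset of $R$ such that $S^{-1}R=R\oplus V$ as $\mathbf{k}$-modules, where the summand $R$ denotes the image of $R$ in $S^{-1}R$ and $V$ is a nonunitary subring of $S^{-1}R$ (a $\mathbf{k}$-submodule closed under multiplication). Then the Rota-Baxter localization of $R$ at $S$ is given by $$S^{-1}_{RB}R=S^{-1}R\oplus\bigoplus_{k\ge 1}\big(S^{-1}R\otimes V^{\otimes k}\big)$$ with the multiplication given by the mixable shuffle product. That is, the $\mathbf{k}$-algebra on the right-hand side (a subalgebra of $(\mathrm{Sha}(S^{-1}R),\diamond)$) carries a Rota-Baxter operator of weight $\lambda$ with which, together with the canonical map from $R$ into its component $S^{-1}R$, it is the Rota-Baxter localization of $(R,P_R)$ at $S$.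
   Context: $\mathbf{k}$ is a commutative unitary ring, $\lambda\in\mathbf{k}$, and all algebras are commutative unital $\mathbf{k}$-algebras unless called nonunitary. A Rota-Baxter algebra of weight $\lambda$ is a pair $(R,P)$ with $R$ an algebra and $P:R\to R$ a $\mathbf{k}$-linear map satisfying $P(x)P(y)=P(xP(y)+P(x)y+\lambda xy)$ for all $x,y\in R$. A morphism $f:(R,P)\to(R',P')$ is an algebra homomorphism with $f\circ P=P'\circ f$. All Rota-Baxter algebras have the same weight $\lambda$. $S^{-1}R$ denotes the usual localization of the commutative algebra $R$, and tensor products are over $\mathbf{k}$. Rota-Baxter localization: for a multiplicative subset $S\subseteq R$, it is a commutative Rota-Baxter algebra $(S^{-1}_{RB}R,S^{-1}P)$ with a Rota-Baxter homomorphism $i_S:R\to S^{-1}_{RB}R$ such that (1) the elements of $i_S(S)$ are invertible; (2) for every commutative Rota-Baxter algebra $(R',P_{R'})$ and Rota-Baxter homomorphism $f:R\to R'$ such that $f(S)$ consists of invertible elements, there is a unique Rota-Baxter homomorphism $f_S:S^{-1}_{RB}R\to R'$ with $f_S\circ i_S=f$. Mixable shuffle product: for a commutative algebra $A$, $\mathrm{Sha}(A)=\bigoplus_{k\ge 1}A^{\otimes k}$ with product $\diamond$ defined on $\mathfrak a=a_0\otimes\cdots\otimes a_m$, $\mathfrak b=b_0\otimes\cdots\otimes b_n$ by: $\mathfrak a\diamond\mathfrak b=(a_0b_0)\otimes b_1\otimes\cdots\otimes b_n$ if $m=0$; $\mathfrak a\diamond\mathfrak b=(a_0b_0)\otimes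 a_1\otimes\cdots\otimes a_m$ if $n=0$; and for $m,n>0$, inductively, $$\mathfrak a\diamond\mathfrak b=(a_0b_0)\otimes\big((a_1\otimes\cdots\otimes a_m)\diamond(1\otimes b_1\otimes\cdots\otimes b_n)+(1\otimes a_1\otimes\cdots\otimes a_m)\diamond(b_1\otimes\cdots\otimes b_n)+\lambda(a_1\otimes\cdots\otimes a_m)\diamond(b_1\otimes\cdots\otimes b_n)\big).$$ Since $V$ is closed under multiplication, $S^{-1}R\oplus\bigoplus_{k\ge 1}(S^{-1}R\otimes V^{\otimes k})$ is closed under $\diamond$ in $\mathrm{Sha}(S^{-1}R)$. It is in general not closed under the standard operator $x\mapsto 1\otimes x$ of $\mathrm{Sha}(S^{-1}R)$, so its Rota-Baxter operator is a different one.
   Formalization: The formal theorem additionally assumes that P_R maps the kernel of R → S^{-1}R into itself; this is automatic if that map is injective, is implied by the conclusion, and without it the claim fails (R=Q×Q, P(a,b)=(b,b), λ=−1, S={(1,y)}, V=0). *)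

(* Defs.v *)
From HB Require Import structures.
From mathcomp Require Import all_boot all_algebra.
From mathcomp Require Import boolp zify ring.

Set Implicit Arguments.
Unset Strict Implicit.
Unset Printing Implicit Defensive.

Import GRing.Theory.
Local Open Scope ring_scope.
Local Open Scope quotient_scope.

(* Commutative unital k-algebras, given by their structure map k -> A.
   MathComp's comAlgType excludes the zero algebra, which does occur as a
   localization, and its hierarchy has no join of pzRingType and lmodType. *)
HB.mixin Record ComPzRing_isKAlgebra (k : comPzRingType) A
    of GRing.ComPzRing A := {
  algmap : k -> A;
  algmap_zmod_morphism : zmod_morphism algmap;
  algmap_monoid_morphism : monoid_morphism algmap
}.

#[short(type="kalgType")]
HB.structure Definition KAlgebra (k : comPzRingType) :=
  {A of GRing.ComPzRing A & ComPzRing_isKAlgebra k A}.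

HB.instance Definition _ (k : comPzRingType) (A : kalgType k) :=
  GRing.isZmodMorphism.Build k A algmap algmap_zmod_morphism.
HB.instance Definition _ (k : comPzRingType) (A : kalgType k) :=
  GRing.isMonoidMorphism.Build k A algmap algmap_monoid_morphism.

Definition kscale (k : comPzRingType) (A : kalgType k) (c : k) (x : A) : A :=
  algmap c * x.

Notation "c *:k x" := (kscale c x) (at level 40) : ring_scope.

Definition klinear (k : comPzRingType) (A B : kalgType k) (f : A -> B) : Prop :=
  forall (c : k) (x y : A), f (c *:k x + y) = c *:k f x + f y.

Definition invertible (A : comPzRingType) (x : A) : Prop :=
  exists y : A, x * y = 1.

Definition alg_morphism (k : comPzRingType) (A B : kalgType k) (f : A -> B) :
  Prop := klinear f /\ monoid_morphism f.

Record mult_subset (R : comPzRingType) : Type := MultSubset {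
  mult_mem :> R -> Prop;
  mult1 : mult_mem 1;
  multM : forall x y, mult_mem x -> mult_mem y -> mult_mem (x * y)
}.

Record nonunitary_subalg (k : comPzRingType) (A : kalgType k) : Type :=
  NonunitarySubalg {
  nonu_mem :> A -> Prop;
  nonu0 : nonu_mem 0;
  nonuD : forall x y, nonu_mem x -> nonu_mem y -> nonu_mem (x + y);
  nonuZ : forall (c : k) x, nonu_mem x -> nonu_mem (c *:k x);
  nonuM : forall x y, nonu_mem x -> nonu_mem y -> nonu_mem (x * y)
}.

Definition is_direct_sum (M : zmodType) (U V : M -> Prop) : Prop :=
  (forall x, exists u v, [/\ U u, V v & x = u + v]) /\
  (forall x, U x -> V x -> x = 0).

Section RotaBaxter.
Variables (k : comPzRingType) (lam : k).

Definition rota_baxter (A : kalgType k) (P : A -> A) : Prop :=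
  klinear P /\
  forall x y, P x * P y = P (x * P y + P x * y + lam *:k (x * y)).

Definition rb_morphism (A B : kalgType k) (P : A -> A)
    (Q : B -> B) (f : A -> B) : Prop :=
  alg_morphism f /\ (forall x, f (P x) = Q (f x)).

Definition is_rb_localization (R : kalgType k) (P : R -> R)
    (S : mult_subset R) (L : kalgType k) (Q : L -> L)
    (i : R -> L) : Prop :=
  [/\ rota_baxter Q,
      rb_morphism P Q i,
      forall s, S s -> invertible (i s) &
      forall (R' : kalgType k) (P' : R' -> R') (f : R -> R'),
        rota_baxter P' -> rb_morphism P P' f ->
        (forall s, S s -> invertible (f s)) ->
        exists g : L -> R',
          [/\ rb_morphism Q P' g,
              forall x, g (i x) = f x &
              forall h : L -> R', rb_morphism Q P' h ->
                (forall x, h (i x) = f x) -> h =1 g]].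

End RotaBaxter.

Section Localization.
Variables (k : comPzRingType) (R : kalgType k) (S : mult_subset R).

Definition denom := {s : R | `[< S s >]}.

Implicit Types (p q : R * denom).

Lemma denomP (s : denom) : S (sval s).
Proof. exact/asboolP/(svalP s). Qed.

Definition denom_of (s : R) (hs : S s) : denom := exist _ s (asboolT hs).
Definition denom1 : denom := denom_of (mult1 S).
Definition denomM (s t : denom) : denom := denom_of (multM (denomP s) (denomP t)).

Definition loc_eqv p q : Prop :=
  exists2 t, S t & t * (p.1 * sval q.2) = t * (q.1 * sval p.2).

Definition loc_eqvb p q : bool := `[< loc_eqv p q >].

Lemma loc_eqvb_refl : reflexive loc_eqvb.
Proof. by move=> p; apply/asboolP; exists 1 => //; exact: mult1. Qed.

Lemma loc_eqvb_sym : symmetric loc_eqvb.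
Proof.
by move=> p q; apply/asboolP/asboolP => -[t St e]; exists t.
Qed.

Lemma loc_eqvb_trans : transitive loc_eqvb.
Proof.
move=> q p r /asboolP[t St et] /asboolP[u Su eu]; apply/asboolP.
exists (sval q.2 * (t * u)).
  by apply: multM; [exact: denomP | exact: multM].
rewrite [LHS](_ : _ = (t * (p.1 * sval q.2)) * (u * sval r.2)); last by ring.
rewrite et [LHS](_ : _ = (u * (q.1 * sval r.2)) * (t * sval p.2)); last by ring.
by rewrite eu; ring.
Qed.

Canonical loc_equiv :=
  EquivRel loc_eqvb loc_eqvb_refl loc_eqvb_sym loc_eqvb_trans.

Definition loc := {eq_quot loc_eqvb}.
HB.instance Definition _ : EqQuotient _ loc_eqvb loc := EqQuotient.on loc.
HB.instance Definition _ := Choice.on loc.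

Definition lfrac (r : R) (s : denom) : loc := \pi_loc (r, s).

Lemma lfracP r s r' s' : lfrac r s = lfrac r' s' <-> loc_eqv (r, s) (r', s').
Proof.
rewrite /lfrac; split=> [/eqmodP|h]; first by move/asboolP.
by apply/eqmodP/asboolP.
Qed.

Lemma lfrac_ind (Q : loc -> Prop) : (forall r s, Q (lfrac r s)) -> forall x, Q x.
Proof. by move=> h x; rewrite -[x]reprK; case: (repr x) => r s; apply: h. Qed.

Lemma lfrac_eq r s r' s' : r * sval s' = r' * sval s -> lfrac r s = lfrac r' s'.
Proof. by move=> e; apply/lfracP; exists 1; [exact: mult1 | rewrite /= e]. Qed.

Lemma repr_lfrac r s : exists2 t, S t &
  t * ((repr (lfrac r s)).1 * sval s) = t * (r * sval (repr (lfrac r s)).2).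
Proof.
have /lfracP [t St e] :
    lfrac (repr (lfrac r s)).1 (repr (lfrac r s)).2 = lfrac r s.
  by rewrite /lfrac -surjective_pairing reprK.
by exists t.
Qed.

Definition loc_add (x y : loc) : loc :=
  let: (r, s) := repr x in let: (r', s') := repr y in
  lfrac (r * sval s' + r' * sval s) (denomM s s').
Definition loc_mul (x y : loc) : loc :=
  let: (r, s) := repr x in let: (r', s') := repr y in
  lfrac (r * r') (denomM s s').
Definition loc_opp (x : loc) : loc := let: (r, s) := repr x in lfrac (- r) s.

Lemma loc_addE r s r' s' : loc_add (lfrac r s) (lfrac r' s') =
  lfrac (r * sval s' + r' * sval s) (denomM s s').
Proof.
rewrite /loc_add; have := repr_lfrac r s; have := repr_lfrac r' s'.
case: (repr (lfrac r s)) => b y; case: (repr (lfrac r' s')) => a x /=.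
move=> [t St et] [u Su eu].
apply/lfracP; exists (t * u); rewrite /=; first exact: multM.
rewrite [LHS](_ : _ = (u * (b * sval s)) * (t * sval x * sval s') +
  (t * (a * sval s')) * (u * sval y * sval s)); last by ring.
by rewrite et eu; ring.
Qed.

Lemma loc_mulE r s r' s' :
  loc_mul (lfrac r s) (lfrac r' s') = lfrac (r * r') (denomM s s').
Proof.
rewrite /loc_mul; have := repr_lfrac r s; have := repr_lfrac r' s'.
case: (repr (lfrac r s)) => b y; case: (repr (lfrac r' s')) => a x /=.
move=> [t St et] [u Su eu].
apply/lfracP; exists (t * u); rewrite /=; first exact: multM.
rewrite [LHS](_ : _ = (u * (b * sval s)) * (t * (a * sval s'))); last by ring.
by rewrite et eu; ring.
Qed.

Lemma loc_oppE r s : loc_opp (lfrac r s) = lfrac (- r) s.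
Proof.
rewrite /loc_opp; have := repr_lfrac r s; case: (repr _) => b y /= [u Su eu].
apply/lfracP; exists u => //=.
rewrite [LHS](_ : _ = - (u * (b * sval s))); last by ring.
by rewrite eu; ring.
Qed.

Fact loc_addA : associative loc_add.
Proof.
elim/lfrac_ind=> a x; elim/lfrac_ind=> b y; elim/lfrac_ind=> c z.
by rewrite !loc_addE; apply: lfrac_eq => /=; ring.
Qed.
Fact loc_addC : commutative loc_add.
Proof.
elim/lfrac_ind=> a x; elim/lfrac_ind=> b y.
by rewrite !loc_addE; apply: lfrac_eq => /=; ring.
Qed.
Fact loc_add0 : left_id (lfrac 0 denom1) loc_add.
Proof.
by elim/lfrac_ind=> a x; rewrite !loc_addE; apply: lfrac_eq => /=; ring.
Qed.
Fact loc_addN : left_inverse (lfrac 0 denom1) loc_opp loc_add.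
Proof.
elim/lfrac_ind=> a x.
by rewrite loc_oppE loc_addE; apply: lfrac_eq => /=; ring.
Qed.
HB.instance Definition _ :=
  GRing.isZmodule.Build loc loc_addA loc_addC loc_add0 loc_addN.

Fact loc_mulA : associative loc_mul.
Proof.
elim/lfrac_ind=> a x; elim/lfrac_ind=> b y; elim/lfrac_ind=> c z.
by rewrite !loc_mulE; apply: lfrac_eq => /=; ring.
Qed.
Fact loc_mulC : commutative loc_mul.
Proof.
elim/lfrac_ind=> a x; elim/lfrac_ind=> b y.
by rewrite !loc_mulE; apply: lfrac_eq => /=; ring.
Qed.
Fact loc_mul1 : left_id (lfrac 1 denom1) loc_mul.
Proof.
by elim/lfrac_ind=> a x; rewrite !loc_mulE; apply: lfrac_eq => /=; ring.
Qed.
Fact loc_mulDl : left_distributive loc_mul +%R.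
Proof.
elim/lfrac_ind=> a x; elim/lfrac_ind=> b y; elim/lfrac_ind=> c z.
rewrite !loc_mulE [X in loc_mul X _]loc_addE loc_mulE [RHS]loc_addE.
by apply: lfrac_eq => /=; ring.
Qed.
HB.instance Definition _ :=
  GRing.Zmodule_isComPzRing.Build loc loc_mulA loc_mulC loc_mul1 loc_mulDl.

Definition to_loc (r : R) : loc := lfrac r denom1.

Fact to_loc_zmod_morphism : zmod_morphism to_loc.
Proof.
move=> x y; rewrite [X in _ = _ + X]loc_oppE [RHS]loc_addE.
by apply: lfrac_eq => /=; ring.
Qed.
Fact to_loc_monoid_morphism : monoid_morphism to_loc.
Proof.
by split=> // x y; rewrite [RHS]loc_mulE; apply: lfrac_eq => /=; ring.
Qed.
HB.instance Definition _ :=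
  GRing.isZmodMorphism.Build R loc to_loc to_loc_zmod_morphism.
HB.instance Definition _ :=
  GRing.isMonoidMorphism.Build R loc to_loc to_loc_monoid_morphism.

Definition loc_algmap (c : k) : loc := to_loc (algmap c).
Fact loc_algmap_zmod_morphism : zmod_morphism loc_algmap.
Proof. by move=> a b; rewrite /loc_algmap !rmorphB. Qed.
Fact loc_algmap_monoid_morphism : monoid_morphism loc_algmap.
Proof. by split=> [|a b]; rewrite /loc_algmap ?rmorph1 ?rmorphM. Qed.
HB.instance Definition _ := ComPzRing_isKAlgebra.Build k loc
  loc_algmap_zmod_morphism loc_algmap_monoid_morphism.

Lemma to_loc_alg_morphism : alg_morphism to_loc.
Proof.
split=> [c x y|]; last exact: to_loc_monoid_morphism.
by rewrite rmorphD rmorphM.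
Qed.

Lemma to_loc_eq0 r : to_loc r = 0 <-> exists2 t, S t & t * r = 0.
Proof.
split=> [/lfracP[t St /= e]|[t St e]].
  by exists t => //; rewrite mul0r mulr1 mulr0 in e.
by apply/lfracP; exists t => //=; rewrite mul0r mulr1 mulr0.
Qed.

Lemma to_loc_invertible s : S s -> invertible (to_loc s).
Proof.
move=> Ss; exists (lfrac 1 (denom_of Ss)).
by rewrite [LHS]loc_mulE; apply: lfrac_eq => /=; ring.
Qed.

Lemma lfrac_to_loc r s : to_loc (sval s) * lfrac r s = to_loc r.
Proof. by rewrite [LHS]loc_mulE; apply: lfrac_eq => /=; ring. Qed.
End Localization.

(* The k-module presented by generators G and relations rel between formal
   k-linear combinations of generators. *)
Section PresentedModule.
Variables (k : comPzRingType) (G : choiceType).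

Definition fsum := seq (k * G).
Implicit Types u v w : fsum.

Definition fscale (c : k) (u : fsum) : fsum := [seq (c * p.1, p.2) | p <- u].

Variable rel : fsum -> fsum -> Prop.

Inductive pres_eq : fsum -> fsum -> Prop :=
| pres_rel u v : rel u v -> pres_eq u v
| pres_refl u : pres_eq u u
| pres_sym u v : pres_eq u v -> pres_eq v u
| pres_trans v u w : pres_eq u v -> pres_eq v w -> pres_eq u w
| pres_cat u u' v v' : pres_eq u u' -> pres_eq v v' ->
    pres_eq (u ++ v) (u' ++ v')
| pres_scale c u v : pres_eq u v -> pres_eq (fscale c u) (fscale c v)
| pres_catC u v : pres_eq (u ++ v) (v ++ u)
| pres_coefD a b g : pres_eq [:: (a, g); (b, g)] [:: (a + b, g)]
| pres_coef0 g : pres_eq [:: (0, g)] [::].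

Definition pres_eqb u v : bool := `[< pres_eq u v >].

Lemma pres_eqb_refl : reflexive pres_eqb.
Proof. by move=> u; apply/asboolP/pres_refl. Qed.
Lemma pres_eqb_sym : symmetric pres_eqb.
Proof. by move=> u v; apply/asboolP/asboolP; apply: pres_sym. Qed.
Lemma pres_eqb_trans : transitive pres_eqb.
Proof.
by move=> v u w /asboolP uv /asboolP vw; apply/asboolP/(pres_trans uv).
Qed.

Canonical pres_equiv :=
  EquivRel pres_eqb pres_eqb_refl pres_eqb_sym pres_eqb_trans.

Definition presmod := {eq_quot pres_eqb}.
HB.instance Definition _ : EqQuotient _ pres_eqb presmod :=
  EqQuotient.on presmod.
HB.instance Definition _ := Choice.on presmod.

Definition pres_class (u : fsum) : presmod := \pi_presmod u.

Lemma pres_classP u v : pres_class u = pres_class v <-> pres_eq u v.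
Proof.
rewrite /pres_class; split=> [/eqmodP|h]; first by move/asboolP.
by apply/eqmodP/asboolP.
Qed.

Lemma pres_class_ind (Q : presmod -> Prop) :
  (forall u, Q (pres_class u)) -> forall x, Q x.
Proof. by move=> h x; rewrite -[x]reprK; apply: h. Qed.

Lemma repr_class u : pres_eq (repr (pres_class u)) u.
Proof. by apply/pres_classP; rewrite /pres_class reprK. Qed.

Definition pres_add (x y : presmod) := pres_class (repr x ++ repr y).
Definition pres_smul (c : k) (x : presmod) := pres_class (fscale c (repr x)).
Definition pres_opp (x : presmod) := pres_smul (- 1) x.

Lemma pres_addE u v :
  pres_add (pres_class u) (pres_class v) = pres_class (u ++ v).
Proof. by apply/pres_classP/pres_cat; apply: repr_class. Qed.

Lemma pres_smulE c u :
  pres_smul c (pres_class u) = pres_class (fscale c u).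
Proof. by apply/pres_classP/pres_scale/repr_class. Qed.

Lemma pres_coefDs a b u :
  pres_eq (fscale a u ++ fscale b u) (fscale (a + b) u).
Proof.
elim: u => [|[c g] u IHu]; first exact: pres_refl.
rewrite -[X in pres_eq X]/([:: (a * c, g)] ++ fscale a u ++
  [:: (b * c, g)] ++ fscale b u).
rewrite -[X in pres_eq _ X]/([:: ((a + b) * c, g)] ++ fscale (a + b) u).
apply: (@pres_trans
  ([:: (a * c, g)] ++ [:: (b * c, g)] ++ fscale a u ++ fscale b u)).
  apply: pres_cat; first exact: pres_refl.
  rewrite !catA; apply: pres_cat; last exact: pres_refl.
  exact: pres_catC.
rewrite catA; apply: pres_cat => //.
by rewrite mulrDl; apply: pres_coefD.
Qed.

Lemma pres_coef0s u : pres_eq (fscale 0 u) [::].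
Proof.
elim: u => [|[c g] u IHu]; first exact: pres_refl.
rewrite /= -cat1s -[[::]]cats0; apply: pres_cat => //.
by rewrite mul0r; apply: pres_coef0.
Qed.

Lemma fscaleA a b u : fscale a (fscale b u) = fscale (a * b) u.
Proof. by rewrite /fscale -map_comp; apply: eq_map => p /=; rewrite mulrA. Qed.

Lemma fscale1 u : fscale 1 u = u.
Proof.
by rewrite /fscale -[RHS]map_id; apply: eq_map => -[c g] /=; rewrite mul1r.
Qed.

Fact pres_addA : associative pres_add.
Proof.
by do 3![elim/pres_class_ind=> ?]; rewrite !pres_addE catA.
Qed.
Fact pres_addC : commutative pres_add.
Proof.
do 2![elim/pres_class_ind=> ?]; rewrite !pres_addE.
exact/pres_classP/pres_catC.
Qed.
Fact pres_add0 : left_id (pres_class [::]) pres_add.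
Proof. by elim/pres_class_ind=> u; rewrite pres_addE. Qed.
Fact pres_addN : left_inverse (pres_class [::]) pres_opp pres_add.
Proof.
elim/pres_class_ind=> u; rewrite /pres_opp pres_smulE pres_addE.
apply/pres_classP; rewrite -[X in _ ++ X]fscale1.
by apply: pres_trans (pres_coefDs _ _ _) _; rewrite addNr; apply: pres_coef0s.
Qed.
HB.instance Definition _ :=
  GRing.isZmodule.Build presmod pres_addA pres_addC pres_add0 pres_addN.

Fact pres_smulA a b x : pres_smul a (pres_smul b x) = pres_smul (a * b) x.
Proof. by elim/pres_class_ind: x => u; rewrite !pres_smulE fscaleA. Qed.
Fact pres_smul1 : left_id 1 pres_smul.
Proof. by elim/pres_class_ind=> u; rewrite !pres_smulE fscale1. Qed.
Fact pres_smulDr : right_distributive pres_smul +%R.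
Proof.
move=> c; do 2![elim/pres_class_ind=> ?].
by rewrite [X in pres_smul _ X]pres_addE !pres_smulE [RHS]pres_addE -map_cat.
Qed.
Fact pres_smulDl x : {morph pres_smul^~ x : a b / a + b}.
Proof.
elim/pres_class_ind: x => u a b; rewrite !pres_smulE [RHS]pres_addE.
exact/pres_classP/pres_sym/pres_coefDs.
Qed.
HB.instance Definition _ := GRing.Zmodule_isLmodule.Build k presmod
  pres_smulA pres_smul1 pres_smulDr pres_smulDl.

Definition pres_gen (g : G) : presmod := pres_class [:: (1, g)].

Lemma pres_classE u : pres_class u = \sum_(p <- u) p.1 *: pres_gen p.2.
Proof.
elim: u => [|[c g] u IHu]; first by rewrite big_nil.
rewrite big_cons -IHu -cat1s -pres_addE; congr (_ + _).
by rewrite [RHS]pres_smulE /= mulr1.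
Qed.

Lemma pres_gen_ind (Q : presmod -> Prop) :
  Q 0 -> (forall c g x, Q x -> Q (c *: pres_gen g + x)) -> forall x, Q x.
Proof.
move=> Q0 QS; elim/pres_class_ind=> u; rewrite pres_classE.
by elim: u => [|p u IHu]; rewrite ?big_nil // big_cons; apply: QS.
Qed.

Definition fsum_eval (M : lmodType k) (f : G -> M) (u : fsum) : M :=
  \sum_(p <- u) p.1 *: f p.2.

Definition respects_rel (M : lmodType k) (f : G -> M) : Prop :=
  forall u v, rel u v -> fsum_eval f u = fsum_eval f v.

(* The k-linear extension of f; meaningful when f respects the relations. *)
Definition pres_lift (M : lmodType k) (f : G -> M) (x : presmod) : M :=
  fsum_eval f (repr x).

Section Lift.
Variables (M : lmodType k) (f : G -> M).
Hypothesis f_rel : respects_rel f.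

Lemma pres_eq_eval u v : pres_eq u v -> fsum_eval f u = fsum_eval f v.
Proof.
have evalZ c w : fsum_eval f (fscale c w) = c *: fsum_eval f w.
  rewrite /fsum_eval big_map scaler_sumr; apply: eq_bigr => p _.
  by rewrite scalerA.
elim=> {u v}; rewrite /fsum_eval; last 3 first.
- by move=> u v; rewrite !big_cat /= addrC.
- by move=> a b g; rewrite !big_cons !big_nil /= !addr0 scalerDl.
- by move=> g; rewrite big_cons big_nil scale0r addr0.
- by move=> u v /f_rel.
- by [].
- by [].
- by move=> v u w _ -> _ ->.
- by move=> u u' v v' _ e _ e'; rewrite !big_cat e e'.
- by move=> c u v _ e; rewrite -!/(fsum_eval f _) in e *; rewrite !evalZ e.
Qed.

Lemma pres_lift_class u : pres_lift f (pres_class u) = fsum_eval f u.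
Proof. exact/pres_eq_eval/repr_class. Qed.

Lemma pres_lift_gen g : pres_lift f (pres_gen g) = f g.
Proof. by rewrite pres_lift_class /fsum_eval big_seq1 scale1r. Qed.

Lemma pres_lift_linear : linear (pres_lift f).
Proof.
move=> c; do 2![elim/pres_class_ind=> ?].
rewrite [c *: _]pres_smulE [X in pres_lift f X]pres_addE !pres_lift_class.
rewrite /fsum_eval big_cat big_map scaler_sumr; congr (_ + _).
by apply: eq_bigr => p _; rewrite scalerA.
Qed.
End Lift.

Lemma pres_lin_ext (M : lmodType k) (f g : presmod -> M) :
  linear f -> linear g -> (forall a, f (pres_gen a) = g (pres_gen a)) -> f =1 g.
Proof.
move=> lf lg fg; elim/pres_gen_ind=> [|c a x IHx].
  pose F := GRing.isLinear.Build k _ _ _ f lf.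
  pose f' : {linear presmod -> M} := HB.pack f F.
  pose F2 := GRing.isLinear.Build k _ _ _ g lg.
  pose g' : {linear presmod -> M} := HB.pack g F2.
  by rewrite -[f]/(f' : _ -> _) -[g]/(g' : _ -> _) !linear0.
by rewrite lf lg fg IHx.
Qed.
End PresentedModule.

Section MixableShuffle.
Variables (k : comPzRingType) (lam : k) (A : kalgType k).

(* The pair (a0, [:: a1; ...; am]) stands for a0 (x) a1 (x) ... (x) am, and
   tpowers is the direct sum over m of the (m + 1)-fold tensor powers of A: the
   relations below are exactly k-linearity in each tensor factor, and they only
   relate words of the same length. *)
Definition word := (A * seq A)%type.

Inductive tensor_rel : fsum k word -> fsum k word -> Prop :=
| tensor_head c x y s :
    tensor_rel [:: (1, (c *:k x + y, s))] [:: (c, (x, s)); (1, (y, s))]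
| tensor_tail a0 s c x y t :
    tensor_rel [:: (1, (a0, s ++ (c *:k x + y) :: t))]
               [:: (c, (a0, s ++ x :: t)); (1, (a0, s ++ y :: t))].

Definition tpowers := presmod tensor_rel.
HB.instance Definition _ := GRing.Lmodule.on tpowers.

Definition pure (a0 : A) (s : seq A) : tpowers := pres_gen tensor_rel (a0, s).

Definition multilinear (M : lmodType k) (f : A -> seq A -> M) : Prop :=
  (forall c x y s, f (c *:k x + y) s = c *: f x s + f y s) /\
  (forall a0 s c x y t, f a0 (s ++ (c *:k x + y) :: t) =
     c *: f a0 (s ++ x :: t) + f a0 (s ++ y :: t)).

Lemma multilinear_respects (M : lmodType k) (f : A -> seq A -> M) :
  multilinear f -> respects_rel tensor_rel (fun w => f w.1 w.2).
Proof.
move=> [fh ft] _ _ [c x y s|a0 s c x y t];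
  by rewrite /fsum_eval !big_cons !big_nil /= !addr0 ?fh ?ft !scale1r.
Qed.

Lemma pure_head c x y s : pure (c *:k x + y) s = c *: pure x s + pure y s.
Proof.
have /pres_classP := pres_rel (tensor_head c x y s).
by rewrite !pres_classE !big_cons !big_nil /= !addr0 !scale1r.
Qed.

Lemma pure_tail a0 s c x y t : pure a0 (s ++ (c *:k x + y) :: t) =
  c *: pure a0 (s ++ x :: t) + pure a0 (s ++ y :: t).
Proof.
have /pres_classP := pres_rel (tensor_tail a0 s c x y t).
by rewrite !pres_classE !big_cons !big_nil /= !addr0 !scale1r.
Qed.

(* The k-linear map with value f a0 s at the pure tensor a0 (x) s. *)
Definition tp_lift (M : lmodType k) (f : A -> seq A -> M) : tpowers -> M :=
  pres_lift (fun w : word => f w.1 w.2).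

Lemma tp_lift_pure (M : lmodType k) (f : A -> seq A -> M) :
  multilinear f -> forall a0 s, tp_lift f (pure a0 s) = f a0 s.
Proof.
by move=> /multilinear_respects h a0 s; rewrite /tp_lift pres_lift_gen.
Qed.

Lemma tp_lift_linear (M : lmodType k) (f : A -> seq A -> M) :
  multilinear f -> linear (tp_lift f).
Proof. by move=> /multilinear_respects/pres_lift_linear. Qed.

Lemma tp_lin_ext (M : lmodType k) (f g : tpowers -> M) : linear f -> linear g ->
  (forall a0 s, f (pure a0 s) = g (pure a0 s)) -> f =1 g.
Proof. by move=> lf lg fg; apply: pres_lin_ext => // -[a0 s]; apply: fg. Qed.

(* x |-> a (x) x, raising the tensor degree by one *)
Definition tcons (a : A) (x : tpowers) : tpowers :=
  tp_lift (fun a0 s => pure a (a0 :: s)) x.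

(* The mixable shuffle product of a0 (x) a1 (x) ... (x) am and
   b0 (x) b1 (x) ... (x) bn; the inner fixpoint only serves the termination
   checker, see msh_consE. *)
Fixpoint msh (a0 : A) (s : seq A) (b0 : A) (t : seq A) {struct s} : tpowers :=
  match s with
  | [::] => pure (a0 * b0) t
  | a1 :: s' =>
    (fix msh_s (a0 b0 : A) (t : seq A) {struct t} : tpowers :=
      match t with
      | [::] => pure (a0 * b0) s
      | b1 :: t' =>
        tcons (a0 * b0)
          (msh a1 s' 1 (b1 :: t') + msh_s 1 b1 t' + lam *: msh a1 s' b1 t')
      end) a0 b0 t
  end.

Lemma msh_nilL a0 b0 t : msh a0 [::] b0 t = pure (a0 * b0) t.
Proof. by []. Qed.

Lemma msh_nilR a0 s b0 : msh a0 s b0 [::] = pure (a0 * b0) s.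
Proof. by case: s. Qed.

Lemma msh_consE a0 a1 s b0 b1 t : msh a0 (a1 :: s) b0 (b1 :: t) =
  tcons (a0 * b0) (msh a1 s 1 (b1 :: t) + msh 1 (a1 :: s) b1 t
                   + lam *: msh a1 s b1 t).
Proof. by []. Qed.

Definition sha_mul (x y : tpowers) : tpowers :=
  tp_lift (fun a0 s => tp_lift (fun b0 t => msh a0 s b0 t) y) x.

Lemma tcons_multilinear a : multilinear (fun a0 s => pure a (a0 :: s)).
Proof.
split=> [c x y s|a0 s c x y t]; first exact: (pure_tail a [::]).
exact: (pure_tail a (a0 :: s)).
Qed.

Lemma tcons_pure a a0 s : tcons a (pure a0 s) = pure a (a0 :: s).
Proof. exact: (tp_lift_pure (tcons_multilinear a)). Qed.

Lemma tcons_linear a : linear (tcons a).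
Proof. exact/tp_lift_linear/tcons_multilinear. Qed.

HB.instance Definition _ a :=
  GRing.isLinear.Build k tpowers tpowers _ (tcons a) (tcons_linear a).

Lemma tconsD a x y : tcons a (x + y) = tcons a x + tcons a y.
Proof. exact: linearD. Qed.
Lemma tconsZ a c x : tcons a (c *: x) = c *: tcons a x.
Proof. exact: linearZ. Qed.

Lemma tcons_head c a b x : tcons (c *:k a + b) x = c *: tcons a x + tcons b x.
Proof.
apply: (@tp_lin_ext _ (tcons (c *:k a + b))
  (fun x => c *: tcons a x + tcons b x)) => [|d y z|a0 s].
- exact: tcons_linear.
- rewrite (tcons_linear a) (tcons_linear b) !scalerDr addrACA !scalerA.
  by rewrite [c * d]mulrC.
- by rewrite !tcons_pure pure_head.
Qed.

Lemma kscale_mull (c : k) (x y : A) : c *:k x * y = c *:k (x * y).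
Proof. by rewrite /kscale mulrA. Qed.

Lemma pureZ c a s : pure (c *:k a) s = c *: pure a s.
Proof.
have := pure_head c a 0 s; have := pure_head 1 0 0 s.
rewrite /kscale !mulr0 !addr0 scale1r => e ->.
have -> : pure 0 s = 0 by apply: (addrI (pure 0 s)); rewrite addr0 -e.
by rewrite addr0.
Qed.

Lemma msh_sym a0 s b0 t : msh a0 s b0 t = msh b0 t a0 s.
Proof.
elim: s a0 b0 t => [|a1 s IHs] a0 b0 t; first by rewrite msh_nilR msh_nilL mulrC.
elim: t a0 b0 => [|b1 t IHt] a0 b0; first by rewrite msh_nilR msh_nilL mulrC.
rewrite !msh_consE mulrC; congr (tcons _ _).
by rewrite IHt (IHs _ 1) (IHs _ b1); congr (_ + _); rewrite addrC.
Qed.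

Lemma msh_head c x y s b0 t :
  msh (c *:k x + y) s b0 t = c *: msh x s b0 t + msh y s b0 t.
Proof.
case: s => [|a1 s]; first by rewrite !msh_nilL mulrDl kscale_mull pure_head.
case: t => [|b1 t]; first by rewrite !msh_nilR mulrDl kscale_mull pure_head.
by rewrite !msh_consE mulrDl kscale_mull tcons_head.
Qed.

Lemma msh_tail a0 s c x y s' b0 t : msh a0 (s ++ (c *:k x + y) :: s') b0 t =
  c *: msh a0 (s ++ x :: s') b0 t + msh a0 (s ++ y :: s') b0 t.
Proof.
elim: s a0 b0 t => [|a1 s IHs] a0 b0 t.
  elim: t a0 b0 => [|b1 t IHt] a0 b0; first by rewrite !msh_nilR pure_tail.
  rewrite !msh_consE -linearP; congr (tcons _ _).
  rewrite (IHt 1 b1) !msh_head !scalerDr !scalerA ![lam * c]mulrC.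
  by rewrite [RHS]addrACA; congr (_ + _); rewrite [RHS]addrACA.
elim: t a0 b0 => [|b1 t IHt] a0 b0.
  by rewrite !msh_nilR (pure_tail _ (a1 :: s)).
rewrite !cat_cons !msh_consE -linearP; congr (tcons _ _).
rewrite -!cat_cons (IHt 1 b1) !cat_cons !IHs !scalerDr !scalerA ![lam * c]mulrC.
by rewrite [RHS]addrACA; congr (_ + _); rewrite [RHS]addrACA.
Qed.

Lemma msh_multilinear b0 t : multilinear (fun a0 s => msh a0 s b0 t).
Proof. by split=> *; [exact: msh_head | exact: msh_tail]. Qed.

Lemma msh_multilinear_r a0 s : multilinear (fun b0 t => msh a0 s b0 t).
Proof.
split=> *; rewrite ![msh a0 s _ _]msh_sym.
  exact: msh_head.
exact: msh_tail.
Qed.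

Lemma sha_mul_multilinear (y : tpowers) :
  multilinear (fun a0 s => tp_lift (fun b0 t => msh a0 s b0 t) y).
Proof.
pose F a0 s y := tp_lift (fun b0 t => msh a0 s b0 t) y.
have FE a0 s b0 t : F a0 s (pure b0 t) = msh a0 s b0 t.
  exact/tp_lift_pure/msh_multilinear_r.
have lF a0 s : linear (F a0 s) by exact/tp_lift_linear/msh_multilinear_r.
have lF2 c (f g : tpowers -> tpowers) : linear f -> linear g -> linear (fun y => c *: f y + g y :> tpowers).
  move=> lf lg d u v; rewrite lf lg !scalerDr addrACA !scalerA.
  by rewrite [c * d]mulrC.
split=> [c x z s|a0 s c x z t].
  refine (tp_lin_ext (lF (c *:k x + z) s)
    (lF2 c (F x s) (F z s) (lF _ _) (lF _ _)) _ y) => b0 t.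
  by rewrite !FE msh_head.
refine (tp_lin_ext (lF a0 (s ++ (c *:k x + z) :: t))
  (lF2 c (F a0 (s ++ x :: t)) (F a0 (s ++ z :: t)) (lF _ _) (lF _ _)) _ y)
  => b0 t'.
by rewrite !FE msh_tail.
Qed.

Lemma sha_mul_pure a0 s b0 t :
  sha_mul (pure a0 s) (pure b0 t) = msh a0 s b0 t.
Proof.
rewrite /sha_mul (tp_lift_pure (sha_mul_multilinear _)).
exact: (tp_lift_pure (msh_multilinear_r _ _)).
Qed.

Lemma sha_mul_linearl y : linear (sha_mul^~ y).
Proof. exact/tp_lift_linear/sha_mul_multilinear. Qed.

Lemma pure_mul_linear a0 s : linear (sha_mul (pure a0 s)).
Proof.
move=> c x y; rewrite /sha_mul !(tp_lift_pure (sha_mul_multilinear _)).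
exact: tp_lift_linear (msh_multilinear_r a0 s) c x y.
Qed.

Lemma sha_mulC : commutative sha_mul.
Proof.
move=> x y.
have lr z : linear (sha_mul z).
  move=> c u v.
  have lc (w w' w'' : tpowers) : linear (fun x => c *: sha_mul x w + sha_mul x w').
    move=> d p q; rewrite !sha_mul_linearl !scalerDr addrACA !scalerA.
    by rewrite [c * d]mulrC.
  apply: (tp_lin_ext (sha_mul_linearl (c *: u + v)) (lc u v v)) => a0 s.
  exact: pure_mul_linear.
apply: (tp_lin_ext (sha_mul_linearl y) (lr y)) => a0 s.
apply: (tp_lin_ext (lr (pure a0 s)) (sha_mul_linearl (pure a0 s))) => b0 t.
by rewrite !sha_mul_pure msh_sym.
Qed.

Lemma sha_mul_linearr x : linear (sha_mul x).
Proof. by move=> c u v; rewrite ![sha_mul x _]sha_mulC sha_mul_linearl. Qed.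

Lemma sha_mulDl x y z : sha_mul (x + y) z = sha_mul x z + sha_mul y z.
Proof. by have := sha_mul_linearl z 1 x y; rewrite !scale1r. Qed.
Lemma sha_mulDr x y z : sha_mul z (x + y) = sha_mul z x + sha_mul z y.
Proof. by rewrite ![sha_mul z _]sha_mulC sha_mulDl. Qed.
Lemma sha_mul0l z : sha_mul 0 z = 0.
Proof. by apply: (addrI (sha_mul 0 z)); rewrite -sha_mulDl !addr0. Qed.
Lemma sha_mulZl c x y : sha_mul (c *: x) y = c *: sha_mul x y.
Proof.
by have := sha_mul_linearl y c x 0; rewrite sha_mul0l !addr0.
Qed.
Lemma sha_mulZr c x y : sha_mul y (c *: x) = c *: sha_mul y x.
Proof. by rewrite ![sha_mul y _]sha_mulC sha_mulZl. Qed.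

Lemma tp_ind (Q : tpowers -> Prop) :
    (forall a0 s, Q (pure a0 s)) -> (forall x y, Q x -> Q y -> Q (x + y)) ->
    (forall c x, Q x -> Q (c *: x)) -> forall x, Q x.
Proof.
move=> Qp QD QZ; apply: pres_gen_ind => [|c [a0 s] x Qx].
  by rewrite -(scale0r (pure 0 [::])); apply/QZ/Qp.
by apply: QD => //; apply/QZ/Qp.
Qed.

Lemma sha_mul_tcons a x b y : sha_mul (tcons a x) (tcons b y) =
  tcons (a * b) (sha_mul x (tcons 1 y) + sha_mul (tcons 1 x) y
                 + lam *: sha_mul x y).
Proof.
elim/tp_ind: x => [a1 s|x x' IH IH'|c x IH]; last 2 first.
- rewrite (tconsD a) (tconsD 1 x) !sha_mulDl IH IH' -tconsD !scalerDr.
  by congr (tcons _ _); rewrite addrACA; congr (_ + _); rewrite addrACA.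
- rewrite !tconsZ !sha_mulZl IH -tconsZ !scalerDr !scalerA.
  by rewrite [c * lam]mulrC.
elim/tp_ind: y => [b1 t|y y' IH IH'|c y IH]; last 2 first.
- rewrite (tconsD b) (tconsD 1 y) !sha_mulDr IH IH' -tconsD !scalerDr.
  by congr (tcons _ _); rewrite addrACA; congr (_ + _); rewrite addrACA.
- rewrite !tconsZ !sha_mulZr IH -tconsZ !scalerDr !scalerA.
  by rewrite [c * lam]mulrC.
by rewrite !tcons_pure !sha_mul_pure msh_consE.
Qed.

Lemma sha_mul_nil_tcons a b y : sha_mul (pure a [::]) (tcons b y) =
  tcons (a * b) y.
Proof.
elim/tp_ind: y => [b1 t|y y' IH IH'|c y IH].
- by rewrite !tcons_pure sha_mul_pure.
- by rewrite !tconsD !sha_mulDr IH IH'.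
by rewrite !tconsZ sha_mulZr IH.
Qed.

Lemma sha_mul_nil a x y : sha_mul (pure a [::]) (sha_mul x y) =
  sha_mul (sha_mul (pure a [::]) x) y.
Proof.
elim/tp_ind: x => [b s|x x' IH IH'|c x IH]; last 2 first.
- by rewrite !(sha_mulDl, sha_mulDr) IH IH'.
- by rewrite !(sha_mulZl, sha_mulZr) IH.
elim/tp_ind: y => [d t|y y' IH IH'|c y IH]; last 2 first.
- by rewrite !sha_mulDr IH IH'.
- by rewrite !sha_mulZr IH.
case: s => [|b1 s].
  case: t => [|d1 t]; first by rewrite !sha_mul_pure !msh_nilL mulrA.
  rewrite -!tcons_pure [sha_mul (pure a _) (pure b _)]sha_mul_pure msh_nilL.
  by rewrite !sha_mul_nil_tcons mulrA.
case: t => [|d1 t].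
  rewrite -!tcons_pure [sha_mul _ (pure d _)]sha_mulC !sha_mul_nil_tcons.
  rewrite [RHS]sha_mulC sha_mul_nil_tcons; congr (tcons _ _).
  by rewrite mulrCA.
rewrite -!tcons_pure sha_mul_tcons !sha_mul_nil_tcons sha_mul_tcons.
by rewrite mulrA.
Qed.

Lemma sha_mulA : associative sha_mul.
Proof.
have H n a0 s b0 t c0 u : (size s + size t + size u < n)%N ->
  sha_mul (pure a0 s) (sha_mul (pure b0 t) (pure c0 u)) =
  sha_mul (sha_mul (pure a0 s) (pure b0 t)) (pure c0 u).
  elim: n => // n IHn in a0 s b0 t c0 u *.
  case: s => [|a1 s]; first by rewrite sha_mul_nil.
  case: t => [|b1 t] sz.
    rewrite (sha_mulC (pure a0 _) (pure b0 _)) -!sha_mul_nil.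
    by rewrite sha_mulC -sha_mul_nil [sha_mul (pure c0 _) _]sha_mulC.
  case: u => [|c1 u] in sz *.
    rewrite ![sha_mul _ (pure c0 _)]sha_mulC sha_mul_nil.
    rewrite -sha_mul_nil [LHS]sha_mulC -sha_mul_nil; congr (sha_mul _ _).
    exact: sha_mulC.
  have P1 x y : sha_mul (tcons 1 x) (tcons 1 y) =
    tcons 1 (sha_mul x (tcons 1 y) + sha_mul (tcons 1 x) y
             + lam *: sha_mul x y) by rewrite sha_mul_tcons mulr1.
  rewrite -!tcons_pure !sha_mul_tcons -!P1 mulrA; congr (tcons _ _).
  rewrite !(sha_mulDl, sha_mulDr, sha_mulZl, sha_mulZr, scalerDr) !tcons_pure.
  rewrite !IHn; try by move: sz => /=; lia.
  rewrite !addrA; congr (_ + _); rewrite [RHS]addrAC; congr (_ + _).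
  by rewrite [LHS]addrAC; congr (_ + _); rewrite [LHS]addrAC.
move=> x y z; elim/tp_ind: x => [a0 s|x x' IH IH'|c x IH]; last 2 first.
- by rewrite !sha_mulDl IH IH'.
- by rewrite !sha_mulZl IH.
elim/tp_ind: y => [b0 t|y y' IH IH'|c y IH]; last 2 first.
- by rewrite !(sha_mulDl, sha_mulDr) IH IH'.
- by rewrite !(sha_mulZl, sha_mulZr) IH.
elim/tp_ind: z => [c0 u|z z' IH IH'|c z IH]; last 2 first.
- by rewrite !sha_mulDr IH IH'.
- by rewrite !sha_mulZr IH.
exact: H (ltnSn _).
Qed.

Lemma sha_mul1 : left_id (pure 1 [::]) sha_mul.
Proof.
move=> x; elim/tp_ind: x => [a0 s|x x' IH IH'|c x IH].
- by rewrite sha_mul_pure msh_nilL mul1r.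
- by rewrite sha_mulDr IH IH'.
by rewrite sha_mulZr IH.
Qed.

(* Sha(A) of weight l. *)
Definition Sha (l : k) := tpowers.
HB.instance Definition _ := GRing.Lmodule.on (Sha lam).
HB.instance Definition _ := GRing.Zmodule_isComPzRing.Build (Sha lam)
  sha_mulA sha_mulC sha_mul1 (fun x y z => sha_mulDl x y z).

Definition msh_algmap (c : k) : Sha lam := pure (algmap c) [::].

Lemma msh_algmapE (c : k) (x : Sha lam) : msh_algmap c * x = c *: x.
Proof.
elim/tp_ind: x => [a0 s|x x' IH IH'|d x IH].
- by rewrite [LHS]sha_mul_pure msh_nilL [LHS]pureZ.
- by rewrite scalerDr mulrDr IH IH'.
by rewrite [LHS]sha_mulZr [sha_mul _ _]IH !scalerA mulrC.
Qed.

Fact msh_algmap_zmod_morphism : zmod_morphism msh_algmap.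
Proof.
move=> c d; rewrite -[LHS]mulr1 -[msh_algmap c]mulr1 -[msh_algmap d]mulr1.
by rewrite !msh_algmapE scalerBl.
Qed.

Fact msh_algmap_monoid_morphism : monoid_morphism msh_algmap.
Proof.
have h1 : msh_algmap 1 = 1 by rewrite /msh_algmap rmorph1.
split=> // c d; rewrite -[LHS]mulr1 msh_algmapE -scalerA -!msh_algmapE.
by rewrite mulr1.
Qed.

HB.instance Definition _ := ComPzRing_isKAlgebra.Build k (Sha lam)
  msh_algmap_zmod_morphism msh_algmap_monoid_morphism.

Lemma msh_kscaleE (c : k) (x : Sha lam) : c *:k x = c *: x.
Proof. exact: msh_algmapE. Qed.
End MixableShuffle.

Arguments Sha {k} A l.
Arguments pure {k A} a0 s.

(* A (+) (+)_(m >= 1) (A (x) V^(x)m) as a subalgebra of Sha(A): finite sums of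
   pure tensors whose factors, except possibly the first, lie in V.  When V is a
   direct summand of A, each A (x) V^(x)m embeds in the (m + 1)-fold tensor
   power of A, so that this is the direct sum of the abstract tensor products. *)
Section MixableShuffleSub.
Variables (k : comPzRingType) (lam : k) (A : kalgType k).
Variable V : nonunitary_subalg A.

Definition tail_in (w : word A) : Prop := forall v, v \in w.2 -> V v.

Definition sha_sub_mem (x : Sha A lam) : Prop :=
  exists2 ws : seq (word A), (forall w, w \in ws -> tail_in w) &
    x = \sum_(w <- ws) pure w.1 w.2.

(* Same with the first factors in H; used below for H = A and H = V only. *)
Definition sha_span (H : A -> Prop) (x : tpowers A) : Prop :=
  exists2 ws : seq (word A), (forall w, w \in ws -> H w.1 /\ tail_in w) &
    x = \sum_(w <- ws) pure w.1 w.2.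

Definition scale_closed (H : A -> Prop) := forall (c : k) a, H a -> H (c *:k a).

Lemma sha_span0 H : sha_span H 0.
Proof. by exists [::] => //; rewrite big_nil. Qed.

Lemma sha_spanD H x y : sha_span H x -> sha_span H y -> sha_span H (x + y).
Proof.
move=> [ws Hws ->] [ws' Hws' ->]; exists (ws ++ ws'); last by rewrite big_cat.
by move=> w; rewrite mem_cat => /orP[/Hws|/Hws'].
Qed.

Lemma sha_span_pure (H : A -> Prop) a0 s :
  H a0 -> (forall v, v \in s -> V v) -> sha_span H (pure a0 s).
Proof.
move=> Ha0 Vs; exists [:: (a0, s)]; last by rewrite big_seq1.
by move=> w; rewrite inE => /eqP ->.
Qed.

Lemma sha_spanZ H c x : scale_closed H -> sha_span H x -> sha_span H (c *: x).
Proof.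
move=> gH [ws Hws ->]; rewrite scaler_sumr.
exists [seq (c *:k w.1, w.2) | w <- ws] => [_ /mapP[w /Hws[Hw tw] ->]|].
  by split; [exact: gH | exact: tw].
rewrite big_map; apply: eq_bigr => -[a s] _ /=.
by rewrite pureZ.
Qed.

Lemma sha_span_tcons H a x : H a -> sha_span V x -> sha_span H (tcons a x).
Proof.
move=> Ha [ws Hws ->]; elim: ws Hws => [|[b s] ws IHws] Hws.
  by rewrite big_nil (linear0 (tcons a)); apply: sha_span0.
rewrite big_cons tconsD tcons_pure; apply: sha_spanD.
  have [Vb Vs] := Hws (b, s) (mem_head _ _).
  by apply: sha_span_pure => // v; rewrite inE => /orP[/eqP->|/Vs].
by apply: IHws => w wws; apply: Hws; rewrite inE wws orbT.
Qed.

Lemma sha_span_msh H a0 s b0 t : scale_closed H -> H (a0 * b0) ->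
  (forall v, v \in s -> V v) -> (forall v, v \in t -> V v) ->
  sha_span H (msh lam a0 s b0 t).
Proof.
have gV : scale_closed V by move=> c a; exact: nonuZ.
elim: s H a0 b0 t => [|a1 s IHs] H a0 b0 t gH Hab Vs Vt.
  by rewrite msh_nilL; apply: sha_span_pure.
elim: t H a0 b0 gH Hab Vt => [|b1 t IHt] H a0 b0 gH Hab Vt.
  by rewrite msh_nilR; apply: sha_span_pure.
have Va1 : V a1 by apply: Vs; exact: mem_head.
have Vb1 : V b1 by apply: Vt; exact: mem_head.
have Vs' v : v \in s -> V v by move=> vs; apply: Vs; rewrite inE vs orbT.
have Vt' v : v \in t -> V v by move=> vt; apply: Vt; rewrite inE vt orbT.
rewrite msh_consE; apply: sha_span_tcons => //; apply: sha_spanD; first apply: sha_spanD.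
- by apply: IHs => //; rewrite mulr1.
- by apply: IHt => //; rewrite mul1r.
by apply/sha_spanZ/IHs => //; apply: nonuM.
Qed.

Lemma sha_spanT x : sha_span (fun _ => True) x <-> sha_sub_mem x.
Proof.
split=> -[ws Hws ->]; exists ws => //.
  by move=> w /Hws[].
by move=> w /Hws.
Qed.

Lemma scale_closedT : scale_closed (fun _ => True). Proof. by []. Qed.

Lemma sha_sub_pure a0 s : (forall v, v \in s -> V v) -> sha_sub_mem (pure a0 s).
Proof. by move=> Vs; apply/sha_spanT/sha_span_pure. Qed.

Lemma sha_sub0 : sha_sub_mem 0.
Proof. exact/sha_spanT/sha_span0. Qed.

Lemma sha_subD x y : sha_sub_mem x -> sha_sub_mem y -> sha_sub_mem (x + y).
Proof. by move=> /sha_spanT ? /sha_spanT ?; apply/sha_spanT/sha_spanD. Qed.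

Lemma sha_subZ c x : sha_sub_mem x -> sha_sub_mem (c *: x).
Proof. by move=> /sha_spanT ?; apply/sha_spanT/sha_spanZ. Qed.

Lemma sha_subM x y : sha_sub_mem x -> sha_sub_mem y -> sha_sub_mem (x * y).
Proof.
move=> [ws Hws ->] [ws' Hws' ->]; rewrite mulr_suml.
elim: ws Hws => [|w ws IH] Hws; first by rewrite big_nil; apply: sha_sub0.
rewrite big_cons; apply: sha_subD; last first.
  by apply: IH => w' w'ws; apply: Hws; rewrite inE w'ws orbT.
have tw : tail_in w by apply: Hws; exact: mem_head.
rewrite mulr_sumr; elim: ws' Hws' {IH Hws} => [|w' ws' IH] Hws'.
  by rewrite big_nil; apply: sha_sub0.
rewrite big_cons; apply: sha_subD; last first.
  by apply: IH => v vws; apply: Hws'; rewrite inE vws orbT.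
have tw' : tail_in w' by apply: Hws'; exact: mem_head.
rewrite [_ * _](sha_mul_pure lam); apply/sha_spanT/sha_span_msh => //.
Qed.

Definition sha_sub_pred : pred (Sha A lam) := fun x => `[< sha_sub_mem x >].

Fact sha_sub_subring_closed : subring_closed sha_sub_pred.
Proof.
split=> [|x y /asboolP hx /asboolP hy|x y /asboolP hx /asboolP hy];
  apply/asboolP; first exact: sha_sub_pure.
- by apply: sha_subD => //; rewrite -scaleN1r; apply: sha_subZ.
- exact: sha_subM.
Qed.

Record sha_sub := ShaSub { sha_sub_val :> Sha A lam;
                           _ : sha_sub_pred sha_sub_val }.
HB.instance Definition _ := [isSub for sha_sub_val].
HB.instance Definition _ := [Choice of sha_sub by <:].
HB.instance Definition _ := GRing.SubChoice_isSubComPzRing.Build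
  (Sha A lam) sha_sub_pred sha_sub sha_sub_subring_closed.

Definition to_sha_sub (x : Sha A lam) (hx : sha_sub_mem x) : sha_sub :=
  ShaSub (asboolT hx).

Lemma sha_subP (x : sha_sub) : sha_sub_mem (sha_sub_val x).
Proof. exact/asboolP/(valP x). Qed.

Lemma tail_in_nil v : v \in ([::] : seq A) -> V v.
Proof. by []. Qed.

Definition sha_sub_inj (a : A) : sha_sub :=
  to_sha_sub (sha_sub_pure a tail_in_nil).

Lemma pure_nil_zmod_morphism (a b : A) :
  pure (a - b) [::] = pure a [::] - pure b [::].
Proof.
rewrite addrC -[RHS]addrC -[- pure b _]scaleN1r.
by rewrite -[in RHS](pure_head (- 1)) /kscale rmorphN1 mulN1r.
Qed.

Fact sha_sub_inj_zmod_morphism : zmod_morphism sha_sub_inj.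
Proof.
move=> a b; apply: val_inj; rewrite raddfB; exact: pure_nil_zmod_morphism.
Qed.

Fact sha_sub_inj_monoid_morphism : monoid_morphism sha_sub_inj.
Proof.
split=> [|a b]; apply: val_inj; rewrite ?rmorph1 ?rmorphM //=.
by rewrite [RHS]sha_mul_pure msh_nilL.
Qed.
HB.instance Definition _ :=
  GRing.isZmodMorphism.Build A sha_sub sha_sub_inj sha_sub_inj_zmod_morphism.
HB.instance Definition _ := GRing.isMonoidMorphism.Build A sha_sub sha_sub_inj
  sha_sub_inj_monoid_morphism.

Definition sha_sub_algmap (c : k) : sha_sub := sha_sub_inj (algmap c).
Fact sha_sub_algmap_zmod_morphism : zmod_morphism sha_sub_algmap.
Proof. by move=> a b; rewrite /sha_sub_algmap !rmorphB. Qed.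
Fact sha_sub_algmap_monoid_morphism : monoid_morphism sha_sub_algmap.
Proof. by split=> [|a b]; rewrite /sha_sub_algmap ?rmorph1 ?rmorphM. Qed.
HB.instance Definition _ := ComPzRing_isKAlgebra.Build k sha_sub
  sha_sub_algmap_zmod_morphism sha_sub_algmap_monoid_morphism.

Lemma sha_sub_val_alg_morphism : alg_morphism sha_sub_val.
Proof.
by split=> //; split.
Qed.
End MixableShuffleSub.

Arguments sha_sub {k} lam {A} V.
Arguments sha_sub_inj {k} lam {A} V a.

(* Main.v *)
Require Import Defs.
From HB Require Import structures.
From mathcomp Require Import all_boot all_algebra.
From mathcomp Require Import boolp ring.

Set Implicit Arguments.
Unset Strict Implicit.
Unset Printing Implicit Defensive.

Import GRing.Theory.
Local Open Scope ring_scope.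

(** Write A = S^-1 R = B (+) V with B the image of R, and let pr : A -> B and
    prV : A -> V be the projections.  By [hker] the operator P descends to B,
    and op : A -> B denotes pr followed by the induced operator.

    Why the answer has this shape: in a Rota-Baxter algebra (R', P') receiving
    A, an iterated expression a0 P'(a1 P'(a2 ...)) with some inner a_i in B can
    be rewritten, because of
      P'(r P'(y)) = P'(r) P'(y) - P'(P'(r) y) - lam P'(r y),
    where P'(r) is the image of op r for r in B.  So only words with all factors
    but the first one in V are left, and nothing else is forced on them.  The
    same formula dictates the operator Q on Sha(A): Q is y |-> 1 (x) y on words
    headed by V, equals P on B, and
      Q(r (x) y) = op r (x) y - Q((op r) y) - lam Q(r y)    for r in B,
    which is a recursion on the length because r (x) y = r Q(y) when y is headed
    by V.

    Q is a Rota-Baxter operator on the subalgebra.  The identity at (x, y) is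
    bilinear and symmetric, so it is enough to treat words, headed by V or by
    B.  For two words headed by V it is the recursive definition of the mixable
    shuffle product; for a scalar in B against a word headed by V it is the
    definition of Q; for two scalars in B it is the identity for P.  A word
    r (x) y1 = r Q(y1) is reduced to shorter ones by [rb_at_mul_image], which
    asks for Q(x) Q(r) Q(y1) to be Q of the triple double product of x, r, y1.
    As that product is symmetric, one may choose which two factors to multiply
    first ([rb_at3_star]), and so avoid circularity: x y1 if x is headed by V
    ([rb_at_V]), x r if x is a scalar in B ([rb_at_r]); the general case
    ([rb_at_sub]) then follows from these two.

    Universal property.  A morphism f : R -> R' inverting S extends uniquely to
    phi : A -> R' ([loc_lift]), and a0 (x) ... (x) am is sent to
    phi(a0) P'(phi(a1) P'(... phi(am))) ([sha_lift]).  This is multiplicative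
    because P' is Rota-Baxter, and intertwines Q and P' by the displayed
    formula.  It is the only possible choice, since words of the subalgebra are
    obtained from A by products and by Q ([rb_morphism_ext]). *)

(** * Linear maps between algebras *)

Section KLinear.
Variables (k : comPzRingType) (A B : kalgType k) (f : A -> B).
Hypothesis lf : klinear f.

Lemma kscale1 (C : kalgType k) (x : C) : 1 *:k x = x.
Proof. by rewrite /kscale rmorph1 mul1r. Qed.

Lemma klinearD x y : f (x + y) = f x + f y.
Proof. by have := lf 1 x y; rewrite !kscale1. Qed.

Lemma klinear0 : f 0 = 0.
Proof. by apply: (addrI (f 0)); rewrite -klinearD !addr0. Qed.

Lemma klinearZ c x : f (c *:k x) = c *:k f x.
Proof. by have := lf c x 0; rewrite klinear0 !addr0. Qed.

Lemma klinearB x y : f (x - y) = f x - f y.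
Proof. by apply: (addIr (f y)); rewrite subrK -klinearD subrK. Qed.

Lemma klinearN x : f (- x) = - f x.
Proof. by rewrite -sub0r klinearB klinear0 sub0r. Qed.
End KLinear.

(** * The Rota-Baxter identity at a pair of elements *)

(** The identity is handled one pair (x, y) at a time because the inductions
    below know it for some pairs only. *)
Section DoubleProduct.
Variables (k : comPzRingType) (lam : k) (L : kalgType k) (Q : L -> L).
Hypothesis lQ : klinear Q.
Implicit Types x y z r : L.

Definition rb_star x y : L := x * Q y + Q x * y + lam *:k (x * y).

Definition rb_at x y : Prop := Q x * Q y = Q (rb_star x y).

(** [rb_star (rb_star x y) z] with [Q (rb_star x y)] replaced by [Q x * Q y]:
    the form in which the symmetry in x, y, z is visible. *)
Definition rb_star3 x y z : L :=
  x * Q y * Q z + Q x * y * Q z + Q x * Q y * z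
  + lam *:k (x * y * Q z + x * Q y * z + Q x * y * z)
  + lam *:k (lam *:k (x * y * z)).

Definition rb_at3 x y z : Prop := Q x * Q y * Q z = Q (rb_star3 x y z).

Lemma rb_at_sym x y : rb_at x y -> rb_at y x.
Proof.
rewrite /rb_at mulrC => ->; congr Q; rewrite /rb_star /kscale; ring.
Qed.

Lemma rb_at3_C23 x y z : rb_at3 x y z -> rb_at3 x z y.
Proof.
by rewrite /rb_at3 mulrAC => ->; congr Q; rewrite /rb_star3 /kscale; ring.
Qed.

Lemma rb_at3_star x y z : rb_at x y -> rb_at (rb_star x y) z -> rb_at3 x y z.
Proof.
move=> xy; rewrite /rb_at3 xy => ->; congr Q.
rewrite /rb_star -/(rb_star x y) -xy /rb_star /rb_star3 /kscale; ring.
Qed.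

Lemma rb_at_addr x y z : rb_at x y -> rb_at x z -> rb_at x (y + z).
Proof.
rewrite /rb_at => xy xz; rewrite (klinearD lQ) mulrDr xy xz -(klinearD lQ).
by congr Q; rewrite /rb_star (klinearD lQ) /kscale; ring.
Qed.

Lemma rb_at_scaler c x y : rb_at x y -> rb_at x (c *:k y).
Proof.
rewrite /rb_at => xy; rewrite (klinearZ lQ).
have -> : Q x * (c *:k Q y) = c *:k (Q x * Q y) by rewrite /kscale mulrCA.
rewrite xy -(klinearZ lQ).
by congr Q; rewrite /rb_star (klinearZ lQ) /kscale; ring.
Qed.

Lemma rb_at0r x : rb_at x 0.
Proof.
by rewrite /rb_at /rb_star (klinear0 lQ) /kscale !mulr0 !addr0 (klinear0 lQ).
Qed.

(** The identity at (r, y) turns [Q (r * Q y)] into [Q r * Q y - Q u], so the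
    identity at (x, r * Q y) splits into a triple one and one at (x, u).  In the
    application u is a sum of words shorter than r (x) y. *)
Lemma rb_at_mul_image x r y : rb_at r y -> rb_at3 x r y ->
  rb_at x (Q r * y + lam *:k (r * y)) -> rb_at x (r * Q y).
Proof.
set u := _ + _ => ry xry xu.
have Qu : Q (r * Q y) = Q r * Q y - Q u.
  by rewrite ry -(klinearB lQ); congr Q; rewrite /rb_star /u /kscale; ring.
rewrite /rb_at /rb_star Qu (mulrBr (Q x)) (mulrA _ (Q r)) xry xu.
rewrite -(klinearB lQ); congr Q.
rewrite /rb_star /rb_star3 /u /kscale; ring.
Qed.
End DoubleProduct.

(** * Words in the mixable shuffle algebra *)

Section ShaSpan.
Variables (k : comPzRingType) (lam : k) (A : kalgType k).
Variable V : nonunitary_subalg A.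

Lemma sha_span_ind (H : A -> Prop) (K : tpowers A -> Prop) :
    K 0 -> (forall x y, K x -> K y -> K (x + y)) ->
    (forall a s, H a -> (forall v, v \in s -> V v) -> K (pure a s)) ->
  forall x, sha_span V H x -> K x.
Proof.
move=> K0 KD Kp x [ws Hws ->]; elim: ws Hws => [|w ws IHws] Hws.
  by rewrite big_nil.
rewrite big_cons; apply: KD.
  by have [Hw Vw] := Hws w (mem_head _ _); apply: Kp.
by apply: IHws => w' w'ws; apply: Hws; rewrite inE w'ws orbT.
Qed.

Lemma pureD (a b : A) s : pure (a + b) s = pure a s + pure b s.
Proof. by have := pure_head 1 a b s; rewrite kscale1 scale1r. Qed.

Lemma pure0 s : pure 0 s = 0 :> tpowers A.
Proof. by apply: (addrI (pure 0 s)); rewrite -pureD !addr0. Qed.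

Lemma pure_mul (a b : A) s :
  (pure a [::] : Sha A lam) * pure b s = pure (a * b) s.
Proof. by rewrite [LHS]sha_mul_pure. Qed.

Lemma pure_mul_tcons (a b : A) x :
  (pure a [::] : Sha A lam) * tcons b x = tcons (a * b) x.
Proof. exact: sha_mul_nil_tcons. Qed.

Lemma tcons_mul (a b : A) x y : (tcons a x : Sha A lam) * tcons b y =
  tcons (a * b) ((x : Sha A lam) * tcons 1 y + (tcons 1 x : Sha A lam) * y
                 + lam *: ((x : Sha A lam) * y)).
Proof. exact: sha_mul_tcons. Qed.

End ShaSpan.

(** * The operator on words with tail in V *)

(** A is the direct sum of a subalgebra B and of V; [prB] is the projection to B
    and [opB] this projection followed by a Rota-Baxter operator of B.  Elements
    of B are those fixed by [prB]. *)
Section Complement.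
Variables (k : comPzRingType) (lam : k) (A : kalgType k).
Variable V : nonunitary_subalg A.
Variables (prB opB : A -> A).
Hypotheses (lprB : klinear prB) (lopB : klinear opB).
Hypothesis prBK : forall x, V (x - prB x).
Hypothesis prB_V : forall v, V v -> prB v = 0.
Hypothesis prB_M : forall x y, prB x = x -> prB y = y -> prB (x * y) = x * y.
Hypothesis prB_opB : forall x, prB (opB x) = opB x.
Hypothesis opB_V : forall v, V v -> opB v = 0.
Hypothesis opB_rb : forall x y, prB x = x -> prB y = y ->
  rb_at lam opB x y.

Let prV (x : A) : A := x - prB x.

(** The second summand is the value at the word headed by [prB a0]; it encodes
    Q(r Q(y)) = Q(r) Q(y) - Q(Q(r) y) - lam Q(r y) for y the word (a1, s'). *)
Fixpoint rbop_word (a0 : A) (s : seq A) : Sha A lam :=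
  pure 1 (prV a0 :: s) +
  match s with
  | [::] => pure (opB a0) [::]
  | a1 :: s' => pure (opB a0) s
                - rbop_word (opB a0 * a1) s' - lam *: rbop_word (prB a0 * a1) s'
  end.

Definition rbop : Sha A lam -> Sha A lam := tp_lift rbop_word.

Lemma prB_id x : prB (prB x) = prB x.
Proof.
have := prB_V (prBK x); rewrite (klinearB lprB).
by move/eqP; rewrite subr_eq0 => /eqP.
Qed.

Lemma lprV : klinear prV.
Proof. by move=> c x y; rewrite /prV lprB /kscale; ring. Qed.

Lemma rbop_word_multilinear : multilinear rbop_word.
Proof.
have hd c x y s : rbop_word (c *:k x + y) s
    = c *: rbop_word x s + rbop_word y s.
  elim: s c x y => [|a1 s IHs] c x y /=; rewrite lprV lopB (pure_tail 1 [::]).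
    by rewrite pure_head !scalerDr addrACA.
  rewrite lprB !mulrDl !kscale_mull !IHs !pure_head !scalerDr !scalerN !scalerA.
  rewrite [lam * c]mulrC !opprD.
  rewrite [RHS]addrACA; congr (_ + _).
  rewrite [RHS]addrACA; congr (_ + _).
  by rewrite [RHS]addrACA.
split=> // a0 s c x y t; elim: s a0 => [|a1 s IHs] a0 /=.
  rewrite (pure_tail 1 [:: _]) (pure_tail _ [::]).
  rewrite !mulrDr ![_ * (c *:k _)]mulrC !kscale_mull !hd.
  rewrite ![x * _]mulrC !scalerDr !scalerN !scalerA [lam * c]mulrC !opprD.
  rewrite [RHS]addrACA; congr (_ + _).
  rewrite [RHS]addrACA; congr (_ + _).
  by rewrite [RHS]addrACA.
rewrite (pure_tail 1 [:: _, a1 & s]) (pure_tail _ (a1 :: s)) !IHs.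
rewrite !scalerDr !scalerN !scalerA [lam * c]mulrC !opprD.
rewrite [RHS]addrACA; congr (_ + _).
rewrite [RHS]addrACA; congr (_ + _).
by rewrite [RHS]addrACA.
Qed.

Lemma rbop_pure a s : rbop (pure a s) = rbop_word a s.
Proof. exact: (tp_lift_pure rbop_word_multilinear). Qed.

Lemma rbop_linear : linear rbop.
Proof. exact: (tp_lift_linear rbop_word_multilinear). Qed.

Lemma rbop_klinear : klinear rbop.
Proof. by move=> c x y; rewrite !msh_kscaleE; apply: rbop_linear. Qed.

Lemma rbop_tcons_V x : sha_span V V x -> rbop x = tcons 1 x.
Proof.
move: x; apply: sha_span_ind.
- by rewrite (klinear0 rbop_klinear) [RHS](linear0 (tcons 1)).
- by move=> x y ex ey; rewrite (klinearD rbop_klinear) tconsD ex ey.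
move=> a s Va _.
rewrite rbop_pure tcons_pure.
have e : prV a = a by rewrite /prV prB_V // subr0.
have r0 : forall t, rbop_word 0 t = 0.
  by move=> t; rewrite -rbop_pure pure0 (klinear0 rbop_klinear).
case: s => [|a1 s]; rewrite /= e opB_V // pure0 ?addr0 //.
by rewrite prB_V // !mul0r r0 scaler0 !subr0 addr0.
Qed.

Lemma rbop_nil r : prB r = r -> rbop (pure r [::]) = pure (opB r) [::].
Proof.
move=> er; rewrite rbop_pure /= /prV er subrr.
have -> : pure 1 [:: 0] = 0 :> tpowers A.
  by rewrite -(tcons_pure 1 0 [::]) pure0 (linear0 (tcons 1)).
by rewrite add0r.
Qed.

(** In both products with a unit head the other head is in V, and V is closed
    under multiplication, so every head of the double product stays in V. *)
Lemma sha_spanV_star x y : sha_span V V x -> sha_span V V y ->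
  sha_span V V (rb_star lam rbop x y).
Proof.
have gV : scale_closed V by move=> c a; exact: nonuZ.
move=> hx hy; rewrite /rb_star (rbop_tcons_V hx) (rbop_tcons_V hy) msh_kscaleE.
move: x hx; apply: sha_span_ind.
- rewrite !mul0r scaler0 [tcons 1 0](linear0 (tcons 1)) mul0r !addr0.
  exact: sha_span0.
- move=> x x' hx hx'; rewrite tconsD !mulrDl scalerDr.
  rewrite [X in X + _]addrACA [X in sha_span _ _ X]addrACA.
  exact: sha_spanD.
move=> a s Va Vs; move: y hy; apply: sha_span_ind.
- rewrite !mulr0 scaler0 [tcons 1 0](linear0 (tcons 1)) mulr0 !addr0.
  exact: sha_span0.
- move=> y y' hy hy'; rewrite tconsD !mulrDr scalerDr.
  rewrite [X in X + _]addrACA [X in sha_span _ _ X]addrACA.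
  exact: sha_spanD.
move=> b t Vb Vt; rewrite !tcons_pure.
rewrite ![_ * _ in X in sha_span _ _ X](sha_mul_pure lam).
have Vcons c u : V c -> (forall v, v \in u -> V v) ->
    forall v, v \in c :: u -> V v.
  by move=> Vc Vu v; rewrite inE => /orP[/eqP->|/Vu].
apply: sha_spanD; first apply: sha_spanD.
- by apply: sha_span_msh => //; rewrite ?mulr1 //; apply: Vcons.
- by apply: sha_span_msh => //; rewrite ?mul1r //; apply: Vcons.
by apply: sha_spanZ => //; apply: sha_span_msh => //; apply: nonuM.
Qed.

Lemma rbop_tcons a x : rbop (tcons a x) = tcons 1 (tcons (prV a) x)
  + (tcons (opB a) x - rbop ((pure (opB a) [::] : Sha A lam) * x)
     - lam *: rbop ((pure (prB a) [::] : Sha A lam) * x)).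
Proof.
elim/tp_ind: x => [b s|x y ex ey|c x ex].
- by rewrite !tcons_pure !pure_mul !rbop_pure.
- rewrite !tconsD !mulrDr !(klinearD rbop_klinear) ex ey !scalerDr !opprD.
  rewrite [LHS]addrACA; congr (_ + _).
  rewrite [LHS]addrACA; congr (_ + _).
  by rewrite [LHS]addrACA.
have rbZ y : rbop (c *: y) = c *: rbop y.
  rewrite -[LHS](congr1 rbop (msh_kscaleE c y)) (klinearZ rbop_klinear).
  by rewrite msh_kscaleE.
have mZ (a' : A) : (pure a' [::] : Sha A lam) * (c *: x)
    = c *: ((pure a' [::] : Sha A lam) * x) by exact: sha_mulZr.
by rewrite !tconsZ !mZ !rbZ ex !scalerDr !scalerN !scalerA [lam * c]mulrC.
Qed.

(** Here the identity is the recursion defining the operator, read backwards. *)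
Lemma rb_at_rV r y : prB r = r -> sha_span V V y ->
  rb_at lam rbop (pure r [::]) y.
Proof.
move=> er hy; rewrite /rb_at /rb_star rbop_nil // (rbop_tcons_V hy).
rewrite !pure_mul_tcons !mulr1 !(klinearD rbop_klinear) (klinearZ rbop_klinear).
rewrite rbop_tcons /prV er subrr !msh_kscaleE.
have -> : tcons 0 y = 0.
  have := tcons_head 1 0 0 y; rewrite kscale1 scale1r addr0 => e.
  by apply: (addrI (tcons 0 y)); rewrite -e addr0.
by rewrite (linear0 (tcons 1)) add0r addrAC !subrK.
Qed.

Lemma rb_at_rr r r' : prB r = r -> prB r' = r' ->
  rb_at lam rbop (pure r [::]) (pure r' [::]).
Proof.
move=> er er'; rewrite /rb_at /rb_star !rbop_nil // !pure_mul.
rewrite msh_kscaleE -!pureD -pureZ -pureD rbop_nil.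
  by rewrite (opB_rb er er').
by rewrite !(klinearD lprB) (klinearZ lprB) !prB_M // prB_opB.
Qed.

(** On words headed by V the operator is the standard one of Sha(A), for which
    the identity is the recursive definition of the product. *)
Lemma rb_at_VV x y : sha_span V V x -> sha_span V V y -> rb_at lam rbop x y.
Proof.
move=> hx hy; rewrite /rb_at (rbop_tcons_V (sha_spanV_star hx hy)).
rewrite /rb_star (rbop_tcons_V hx) (rbop_tcons_V hy) tcons_mul mulr1.
by rewrite msh_kscaleE.
Qed.

Lemma pure_split b s :
  pure b s = pure (prB b) s + pure (prV b) s :> Sha A lam.
Proof. by rewrite -pureD addrC subrK. Qed.

Lemma pure_cons_factor a b s : V b -> (forall v, v \in s -> V v) ->
  pure a (b :: s) = (pure a [::] : Sha A lam) * rbop (pure b s).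
Proof.
move=> Vb Vs; rewrite rbop_tcons_V; last exact: sha_span_pure.
by rewrite pure_mul_tcons mulr1 tcons_pure.
Qed.

(** Induction on the length of y: split its head along B (+) V, and treat
    r (x) y1 with r in B as the product of r and Q(y1). *)
Lemma rb_at_words (x : Sha A lam) :
  (forall r, prB r = r -> rb_at lam rbop x (pure r [::])) ->
  (forall y, sha_span V V y -> rb_at lam rbop x y) ->
  (forall r b s, prB r = r -> V b -> (forall v, v \in s -> V v) ->
    rb_at3 lam rbop x (pure r [::]) (pure b s)) ->
  forall y, sha_sub_mem V y -> rb_at lam rbop x y.
Proof.
move=> hr hV h3 y /sha_spanT; move: y; apply: sha_span_ind.
- exact: rb_at0r rbop_klinear _.
- by move=> y z; apply: rb_at_addr rbop_klinear _ _ _.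
move=> b s _; elim: s b => [|b1 s IHs] b Vs.
  rewrite pure_split; apply: (rb_at_addr rbop_klinear).
    by apply: hr; apply: prB_id.
  by apply: hV; apply: sha_span_pure => //; apply: prBK.
have Vb1 : V b1 by apply: Vs; apply: mem_head.
have Vs' v : v \in s -> V v by move=> vs; apply: Vs; rewrite inE vs orbT.
rewrite pure_split; apply: (rb_at_addr rbop_klinear); last first.
  by apply: hV; apply: sha_span_pure => //; apply: prBK.
rewrite pure_cons_factor //; apply: (rb_at_mul_image rbop_klinear).
- by apply: rb_at_rV; [apply: prB_id|apply: sha_span_pure].
- by apply: h3 => //; apply: prB_id.
rewrite rbop_nil ?prB_id // !pure_mul.
apply: (rb_at_addr rbop_klinear); first exact: IHs.
by apply: (rb_at_scaler rbop_klinear); apply: IHs.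
Qed.

(** The triple identity is reached through [rb_star x y1], headed by V;
    going through [rb_star x r] instead would need the case r (x) x against y1,
    which is the statement being proved with x and y1 exchanged. *)
Lemma rb_at_V x y : sha_span V V x -> sha_sub_mem V y -> rb_at lam rbop x y.
Proof.
move=> hx; apply: rb_at_words => [r er|z hz|r b s er Vb Vs].
- by apply/rb_at_sym/rb_at_rV.
- exact: rb_at_VV.
have hb : sha_span V V (pure b s) by apply: sha_span_pure.
apply/rb_at3_C23/rb_at3_star; first exact: rb_at_VV.
by apply/rb_at_sym/rb_at_rV => //; apply: sha_spanV_star.
Qed.

(** Here the triple identity is reached through [rb_star r r'], a scalar in
    B, so that [rb_at_rV] applies. *)
Lemma rb_at_r r y : prB r = r -> sha_sub_mem V y ->
  rb_at lam rbop (pure r [::]) y.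
Proof.
move=> er; apply: rb_at_words => [r' er'|z hz|r' b s er' Vb Vs].
- exact: rb_at_rr.
- exact: rb_at_rV.
apply: rb_at3_star; first exact: rb_at_rr.
rewrite /rb_star !rbop_nil // !pure_mul msh_kscaleE -!pureD -pureZ -pureD.
apply: rb_at_rV; last exact: sha_span_pure.
by rewrite !(klinearD lprB) (klinearZ lprB) !prB_M // prB_opB.
Qed.

Lemma rbop_sub x : sha_sub_mem V x -> sha_sub_mem V (rbop x).
Proof.
move/sha_spanT; move: x; apply: sha_span_ind.
- by rewrite (klinear0 rbop_klinear); apply: sha_sub0.
- by move=> x y hx hy; rewrite (klinearD rbop_klinear); apply: sha_subD.
have subN x : sha_sub_mem V x -> sha_sub_mem V (- x : Sha A lam).
  by move=> hx; rewrite -scaleN1r; apply: sha_subZ.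
move=> a s _; rewrite rbop_pure; elim: s a => [|a1 s IHs] a Vs /=.
  apply: sha_subD; apply: sha_sub_pure => // v.
  by rewrite inE => /eqP ->; apply: prBK.
have Vs' v : v \in s -> V v by move=> vs; apply: Vs; rewrite inE vs orbT.
apply: sha_subD.
  by apply: sha_sub_pure => v; rewrite inE => /orP[/eqP->|/Vs]//; apply: prBK.
apply: sha_subD; first apply: sha_subD.
- exact: sha_sub_pure.
- by apply/subN/IHs.
by apply/subN/sha_subZ/IHs.
Qed.

Lemma rb_at_sub x y : sha_sub_mem V x -> sha_sub_mem V y -> rb_at lam rbop x y.
Proof.
move=> hx hy; apply/rb_at_sym; move: x hx.
apply: rb_at_words => [r er|z hz|r b s er Vb Vs].
- by apply/rb_at_sym/rb_at_r.
- by apply/rb_at_sym/rb_at_V.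
have hb : sha_span V V (pure b s) by apply: sha_span_pure.
have sb : sha_sub_mem V (pure b s : Sha A lam) by apply: sha_sub_pure.
apply/rb_at3_C23/rb_at3_star; first by apply/rb_at_sym/rb_at_V.
apply/rb_at_sym/rb_at_r => //; rewrite /rb_star msh_kscaleE.
apply: sha_subD; first by apply: sha_subD; apply: sha_subM => //; apply: rbop_sub.
by apply: sha_subZ; apply: sha_subM.
Qed.

Definition rbop_on_sub (x : sha_sub lam V) : sha_sub lam V :=
  to_sha_sub (rbop_sub (sha_subP x)).

Lemma rbop_on_sub_rota_baxter : rota_baxter lam rbop_on_sub.
Proof.
have [lval [_ valM]] := sha_sub_val_alg_morphism lam V.
have valQ x : sha_sub_val (rbop_on_sub x) = rbop (sha_sub_val x) by [].
have valI : injective (@sha_sub_val k lam A V) by apply: val_inj.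
split=> [c x y|x y]; apply: valI.
  by rewrite lval valQ lval rbop_klinear !valQ.
have := rb_at_sub (sha_subP x) (sha_subP y).
by rewrite /rb_at /rb_star valM !valQ !(klinearD lval) (klinearZ lval) !valM.
Qed.

(** A word a (x) y with y headed by V is a Q(y), so A generates the subalgebra
    as a Rota-Baxter algebra. *)
Lemma rb_morphism_ext (B : kalgType k) (P : B -> B) (h h' : sha_sub lam V -> B) :
  rb_morphism rbop_on_sub P h -> rb_morphism rbop_on_sub P h' ->
  (forall a, h (sha_sub_inj lam V a) = h' (sha_sub_inj lam V a)) -> h =1 h'.
Proof.
move=> [[lh [_ hM]] hQ] [[lh' [_ hM']] hQ'] hh' x.
have [lval [_ valM]] := sha_sub_val_alg_morphism lam V.
suff [y /val_inj -> //] : exists2 y : sha_sub lam V,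
  sha_sub_val y = sha_sub_val x & h y = h' y.
have /sha_spanT := sha_subP x; move: (sha_sub_val x); apply: sha_span_ind.
- by exists 0; rewrite ?(klinear0 lh) ?(klinear0 lh') ?(klinear0 lval).
- move=> _ _ [y <- hy] [z <- hz]; exists (y + z).
    by rewrite (klinearD lval).
  by rewrite (klinearD lh) (klinearD lh') hy hz.
move=> a s _; elim: s a => [|b s IHs] a Vs; first by exists (sha_sub_inj lam V a).
have Vb : V b by apply: Vs; apply: mem_head.
have Vs' v : v \in s -> V v by move=> vs; apply: Vs; rewrite inE vs orbT.
have [y ey hy] := IHs b Vs'.
exists (sha_sub_inj lam V a * rbop_on_sub y); last first.
  by rewrite hM hM' hh' hQ hQ' hy.
by rewrite valM [sha_sub_val (rbop_on_sub y)]/= ey [RHS]pure_cons_factor.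
Qed.

End Complement.

Arguments rbop {k} lam {A} prB opB x.
Arguments rbop_klinear {k} lam {A prB opB} lprB lopB.

(** * Extending a morphism of A to Sha(A) *)

(** A copy of B that carries its k-module structure, to be the target of
    k-linear maps out of Sha(A). *)
Definition kmod (k : comPzRingType) (B : kalgType k) : Type := B.

Section KMod.
Variables (k : comPzRingType) (B : kalgType k).
HB.instance Definition _ := GRing.Zmodule.on (kmod B).

Let kscaleA (c d : k) (x : kmod B) : c *:k (d *:k x) = (c * d) *:k x.
Proof. by rewrite /kscale rmorphM mulrA. Qed.
Let kscaleDr : right_distributive (@kscale k B) +%R.
Proof. by move=> c x y; rewrite /kscale mulrDr. Qed.
Let kscaleDl (x : kmod B) : {morph (@kscale k B)^~ x : a b / a + b}.
Proof. by move=> a b; rewrite /kscale rmorphD mulrDl. Qed.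
HB.instance Definition _ := GRing.Zmodule_isLmodule.Build k (kmod B)
  kscaleA (@kscale1 k B) kscaleDr kscaleDl.
End KMod.

Section ShaLift.
Variables (k : comPzRingType) (lam : k) (A B : kalgType k).
Variables (P : B -> B) (phi : A -> B).
Hypotheses (rbP : rota_baxter lam P) (phiM : alg_morphism phi).

(** phi(a0) P(phi(a1) P(... phi(am))) *)
Fixpoint nest (a0 : A) (s : seq A) : kmod B :=
  phi a0 * (if s is a1 :: s' then P (nest a1 s') else 1).

Definition sha_lift : Sha A lam -> B := tp_lift nest.

Let lP : klinear P := rbP.1.
Let lphi : klinear phi := phiM.1.

Lemma nest_multilinear : multilinear nest.
Proof.
have hd c x y s : nest (c *:k x + y) s = c *: nest x s + nest y s.
  by case: s => [|a1 s] /=; rewrite lphi mulrDl kscale_mull.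
split=> // a0 s c x y t; elim: s a0 => [|a1 s IHs] a0 /=.
  by rewrite hd lP mulrDr mulrCA.
by rewrite IHs lP mulrDr mulrCA.
Qed.

Lemma sha_lift_pure a s : sha_lift (pure a s) = nest a s.
Proof. exact: (tp_lift_pure nest_multilinear). Qed.

Lemma sha_lift_klinear : klinear sha_lift.
Proof.
by move=> c x y; rewrite msh_kscaleE; apply: (tp_lift_linear nest_multilinear).
Qed.

Let sha_liftZ c x : sha_lift (c *: x) = c *:k sha_lift x.
Proof. by rewrite -msh_kscaleE (klinearZ sha_lift_klinear). Qed.

Lemma sha_lift_tcons a x : sha_lift (tcons a x) = phi a * P (sha_lift x).
Proof.
elim/tp_ind: x => [b s|x y ex ey|c x ex].
- by rewrite tcons_pure !sha_lift_pure.
- by rewrite tconsD !(klinearD sha_lift_klinear) ex ey (klinearD lP) mulrDr.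
by rewrite tconsZ !sha_liftZ ex (klinearZ lP) /kscale mulrCA.
Qed.

(** The recursion for the product is the Rota-Baxter identity of P, applied to
    the values of the two tails. *)
Lemma sha_lift_msh a s b t :
  sha_lift (msh lam a s b t) = sha_lift (pure a s) * sha_lift (pure b t).
Proof.
have [phi1 phiMM] := phiM.2.
have nilL c d u : sha_lift (pure (c * d) u) =
    sha_lift (pure c [::]) * sha_lift (pure d u).
  by rewrite !sha_lift_pure; case: u => [|e u] /=; rewrite phiMM !mulr1 ?mulrA.
elim: s a b t => [|a1 s IHs] a b t; first by rewrite msh_nilL nilL.
elim: t a b => [|b1 t IHt] a b.
  by rewrite msh_nilR mulrC nilL mulrC.
rewrite msh_consE sha_lift_tcons !(klinearD sha_lift_klinear) sha_liftZ.
rewrite IHt !IHs -!tcons_pure !sha_lift_tcons phi1 !mul1r phiMM.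
by rewrite [RHS]mulrACA rbP.2.
Qed.

Lemma sha_liftM x y : sha_lift (x * y) = sha_lift x * sha_lift y.
Proof.
elim/tp_ind: x => [a s|x x' ex ex'|c x ex].
- elim/tp_ind: y => [b t|y y' ey ey'|c y ey].
  + by rewrite [_ * _](sha_mul_pure lam) sha_lift_msh.
  + by rewrite mulrDr !(klinearD sha_lift_klinear) ey ey' mulrDr.
  rewrite [_ * _](sha_mulZr lam) !sha_liftZ.
  by rewrite -[sha_mul lam _ _]/(_ * _ : Sha A lam) ey /kscale mulrCA.
- by rewrite mulrDl !(klinearD sha_lift_klinear) ex ex' mulrDl.
rewrite [_ * _](sha_mulZl lam) !sha_liftZ.
by rewrite -[sha_mul lam _ _]/(_ * _ : Sha A lam) ex /kscale mulrA.
Qed.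

Lemma sha_lift_alg_morphism : alg_morphism sha_lift.
Proof.
split; first exact: sha_lift_klinear.
split; last exact: sha_liftM.
by rewrite (sha_lift_pure 1 [::]) /= mulr1 phiM.2.1.
Qed.

(** On words headed by B this is the identity P(r P(y)) = P(r) P(y) - P(P(r) y)
    - lam P(r y), by induction on the length. *)
Lemma sha_lift_rbop (prB opB : A -> A) :
  klinear prB -> klinear opB ->
  (forall x, phi (opB x) = P (phi (prB x))) ->
  forall x, sha_lift (rbop lam prB opB x) = P (sha_lift x).
Proof.
move=> lprB lopB phi_op x; have [phi1 phiMM] := phiM.2.
have rl := rbop_klinear lam lprB lopB.
elim/tp_ind: x => [a s|x y ex ey|c x ex]; last 2 first.
- by rewrite (klinearD rl) !(klinearD sha_lift_klinear) ex ey (klinearD lP).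
- rewrite -!msh_kscaleE (klinearZ rl) !(klinearZ sha_lift_klinear) ex.
  by rewrite (klinearZ lP).
rewrite rbop_pure //; elim: s a => [|b s IHs] a /=.
  rewrite (klinearD sha_lift_klinear) !sha_lift_pure /=.
  rewrite phi1 mul1r phi_op !mulr1 -(klinearD lP) -(klinearD lphi).
  by rewrite subrK.
rewrite !(klinearD sha_lift_klinear) !(klinearN sha_lift_klinear) sha_liftZ !IHs.
rewrite !sha_lift_pure.
have nestM c d u : nest (c * d) u = phi c * nest d u.
  by case: u => [|e u] /=; rewrite phiMM mulrA.
rewrite !nestM /= phi_op phi1 mul1r rbP.2.
rewrite -(klinearZ lP) -!(klinearN lP) -!(klinearD lP); congr P.
rewrite (klinearB lphi) /kscale.
ring.
Qed.

End ShaLift.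

Arguments sha_lift {k} lam {A B} P phi x.

(** * The universal property of S^-1 R *)

Section LocLift.
Variables (k : comPzRingType) (R B : kalgType k) (S : mult_subset R).
Variable f : R -> B.
Hypotheses (fM : alg_morphism f) (fS : forall s, S s -> invertible (f s)).

Definition loc_lift (x : loc S) : B :=
  let: (r, s) := repr x in f r * sval (cid (fS (denomP s))).

Lemma invertible_inj (u x y : B) : invertible u -> u * x = u * y -> x = y.
Proof.
move=> [v uv] e; rewrite -[x]mul1r -[y]mul1r -uv [u * v]mulrC.
by rewrite -!mulrA e.
Qed.

Lemma loc_lift_frac r s : f (sval s) * loc_lift (lfrac r s) = f r.
Proof.
have [f1 fMM] := fM.2.
rewrite /loc_lift; have := repr_lfrac r s; case: (repr _) => a x /= [t St].
move=> /(congr1 f); rewrite !fMM => /(invertible_inj (fS St)) e.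
case: cid => v /= xv.
by rewrite mulrA [f _ * f a]mulrC e -mulrA xv mulr1.
Qed.

Lemma loc_lift_unique (h : loc S -> B) : monoid_morphism h ->
  (forall r, h (to_loc S r) = f r) -> h =1 loc_lift.
Proof.
move=> [_ hM] hf; elim/lfrac_ind=> r s.
apply: (invertible_inj (fS (denomP s))).
by rewrite loc_lift_frac -hf -hM lfrac_to_loc.
Qed.

Lemma loc_lift_to_loc r : loc_lift (to_loc S r) = f r.
Proof.
have := loc_lift_frac r (denom1 S); rewrite /= fM.2.1 mul1r; exact.
Qed.

Lemma loc_lift_alg_morphism : alg_morphism loc_lift.
Proof.
have [f1 fMM] := fM.2; have lf := fM.1.
have eqf (s : denom S) r x : f (sval s) * x = f r -> loc_lift (lfrac r s) = x.
  by move=> e; apply: (invertible_inj (fS (denomP s))); rewrite loc_lift_frac e.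
have lM x y : loc_lift (x * y) = loc_lift x * loc_lift y.
  elim/lfrac_ind: x => a s; elim/lfrac_ind: y => b t.
  rewrite [_ * _]loc_mulE; apply: eqf => /=.
  by rewrite !fMM mulrACA !loc_lift_frac.
have lD x y : loc_lift (x + y) = loc_lift x + loc_lift y.
  elim/lfrac_ind: x => a s; elim/lfrac_ind: y => b t.
  rewrite [_ + _]loc_addE; apply: eqf => /=.
  rewrite (klinearD lf) !fMM -(loc_lift_frac a s) -(loc_lift_frac b t).
  ring.
split; last by split=> //; rewrite -f1 -loc_lift_to_loc rmorph1.
move=> c x y; rewrite lD lM; congr (_ * _ + _).
rewrite [algmap c]/(to_loc S (algmap c)) loc_lift_to_loc.
by rewrite -[algmap c in LHS]mulr1 [LHS](klinearZ lf) f1 /kscale mulr1.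
Qed.
End LocLift.

(** * The operator induced on the image of R *)

Section ImageComplement.
Variables (k : comPzRingType) (lam : k) (R : kalgType k) (P : R -> R).
Variables (S : mult_subset R) (V : nonunitary_subalg (loc S)).
Hypothesis hP : rota_baxter lam P.
Hypothesis hV :
  is_direct_sum (fun x : loc S => exists r : R, x = to_loc S r) V.
Hypothesis hker : forall r : R, to_loc S r = 0 -> to_loc S (P r) = 0.

Lemma image_part_ex (x : loc S) : exists r : R, V (x - to_loc S r).
Proof.
have [_ [v [[r ->] Vv ->]]] := hV.1 x.
by exists r; rewrite addrC addKr.
Qed.

(** A preimage in R of the component of x in the image of R; it is determined up
    to the kernel of R -> S^-1 R only, which P preserves. *)
Definition image_part (x : loc S) : R := sval (cid (image_part_ex x)).

Lemma image_partP x : V (x - to_loc S (image_part x)).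
Proof. exact: svalP (cid (image_part_ex x)). Qed.

Lemma image_part_unique x r : V (x - to_loc S r) ->
  to_loc S (image_part x) = to_loc S r /\
  to_loc S (P (image_part x)) = to_loc S (P r).
Proof.
move=> Vr; have Vx := image_partP x.
have locB := klinearB (to_loc_alg_morphism S).1.
have e0 : to_loc S (image_part x - r) = 0.
  apply: hV.2; first by eexists.
  have := nonuD Vr (nonuZ (-1) Vx); rewrite /kscale rmorphN1 mulN1r locB.
  by congr (nonu_mem V _); ring.
have := hker e0; rewrite (klinearB hP.1) => e1; split.
  by apply/eqP; rewrite -subr_eq0 -locB e0.
by apply/eqP; rewrite -subr_eq0 -locB e1.
Qed.

Definition prR (x : loc S) : loc S := to_loc S (image_part x).
Definition opR (x : loc S) : loc S := to_loc S (P (image_part x)).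

Lemma opR_unique x r : V (x - to_loc S r) ->
  prR x = to_loc S r /\ opR x = to_loc S (P r).
Proof. exact: image_part_unique. Qed.

Lemma opR_to_loc r : prR (to_loc S r) = to_loc S r /\
  opR (to_loc S r) = to_loc S (P r).
Proof. by apply: opR_unique; rewrite subrr; apply: nonu0. Qed.

Lemma prR_opR_klinear : klinear prR /\ klinear opR.
Proof.
have lloc := (to_loc_alg_morphism S).1.
have h c x y : prR (c *:k x + y) = c *:k prR x + prR y /\
               opR (c *:k x + y) = c *:k opR x + opR y.
  have := @opR_unique (c *:k x + y) (c *:k image_part x + image_part y).
  rewrite hP.1 !lloc; apply.
  have := nonuD (nonuZ c (image_partP x)) (image_partP y).
  by congr (nonu_mem V _); rewrite /kscale; ring.
by split=> c x y; have [] := h c x y.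
Qed.

Lemma prR_V v : V v -> prR v = 0 /\ opR v = 0.
Proof.
move=> Vv; have [] := @opR_unique v 0; first by rewrite rmorph0 subr0.
by rewrite (klinear0 hP.1) rmorph0.
Qed.

Lemma prR_M x y : prR x = x -> prR y = y -> prR (x * y) = x * y.
Proof. by move=> <- <-; rewrite -rmorphM (opR_to_loc _).1. Qed.

Lemma opR_rb x y : prR x = x -> prR y = y -> rb_at lam opR x y.
Proof.
have [_ locM] := (to_loc_alg_morphism S).2.
have lloc := (to_loc_alg_morphism S).1.
move=> <- <-; rewrite /rb_at /rb_star /prR !(opR_to_loc _).2 -!locM.
rewrite -(klinearZ lloc) -!(klinearD lloc) (opR_to_loc _).2.
by rewrite hP.2.
Qed.
End ImageComplement.

(** * The localization *)

(* hker says that P induces an operator on the image of R in S^-1 R.  It holds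
   whenever R -> S^-1 R is injective, and the conclusion implies it. *)
Theorem theorem3p1 (k : comPzRingType) (lam : k)
  (R : kalgType k) (P : R -> R) (hP : rota_baxter lam P)
  (S : mult_subset R) (V : nonunitary_subalg (loc S))
  (hV : is_direct_sum (fun x : loc S => exists r : R, x = to_loc S r) V)
  (hker : forall r : R, to_loc S r = 0 -> to_loc S (P r) = 0) :
  exists Q : sha_sub lam V -> sha_sub lam V,
    is_rb_localization lam P S Q (fun r : R => sha_sub_inj lam V (to_loc S r)).
Proof.
pose pr := prR hV; pose op := opR P hV.
have [lpr lop] : klinear pr /\ klinear op := prR_opR_klinear hP hV hker.
have prK x : V (x - pr x) := image_partP hV x.
have pr_V v : V v -> pr v = 0 by move=> /(prR_V hP hV hker)[].
have op_V v : V v -> op v = 0 by move=> /(prR_V hP hV hker)[].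
have prM := prR_M hP (hV := hV) hker.
have oploc r : pr (to_loc S r) = to_loc S r /\ op (to_loc S r) = to_loc S (P r).
  exact: opR_to_loc hP hV hker r.
have pr_op x : pr (op x) = op x by apply: (oploc _).1.
have op_rb := opR_rb hP (hV := hV) hker.
pose Q := rbop_on_sub (lam := lam) lpr lop prK.
have rbQ : rota_baxter lam Q.
  exact: rbop_on_sub_rota_baxter prM pr_op op_V op_rb.
have [lval [val1 valM]] := sha_sub_val_alg_morphism lam V.
exists Q; split=> //.
- split; first split.
  + by move=> c x y; rewrite !(rmorphD, rmorphM).
  + by split=> [|x y]; rewrite ?rmorph1 ?rmorphM.
  move=> r; apply: val_inj; rewrite /= rbop_nil ?(oploc r).2 //.
  exact: (oploc r).1.
- move=> s Ss; have [y sy] := to_loc_invertible Ss.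
  by exists (sha_sub_inj lam V y); rewrite -rmorphM sy rmorph1.
move=> B P' f rbP' [fM fP] fS.
pose phi := loc_lift fS.
have phiM : alg_morphism phi := loc_lift_alg_morphism fM fS.
have phi_op x : phi (op x) = P' (phi (pr x)).
  by rewrite /phi /op /pr /opR /prR !(loc_lift_to_loc fM) fP.
pose g (x : sha_sub lam V) := sha_lift lam P' phi (sha_sub_val x).
have gE a : g (sha_sub_inj lam V a) = phi a.
  by rewrite /g /= sha_lift_pure //= mulr1.
have gRB : rb_morphism Q P' g.
  have [lG [G1 GM]] := sha_lift_alg_morphism rbP' phiM.
  split; last by move=> x; rewrite -(sha_lift_rbop rbP' phiM lpr lop phi_op).
  split; first by move=> c x y; rewrite /g lval lG.
  by split=> [|x y]; rewrite /g ?val1 ?valM.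
exists g; split=> //; first by move=> r; rewrite gE /phi loc_lift_to_loc.
move=> h hRB hf; apply: (rb_morphism_ext pr_V op_V hRB gRB) => a; rewrite gE.
apply: (loc_lift_unique fM fS (h := fun a => h (sha_sub_inj lam V a))) => //.
have [[_ [h1 hM]] _] := hRB.
by split=> [|x y]; rewrite ?rmorph1 ?rmorphM.
Qed.
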